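(* Let $\nu>0$, $\boldsymbol q$ be a branching mechanism, $R_0\in\mathcal P(\mathcal M_\delta(\mathbb T^d))$ and $R\sim\mathrm{BBM}(\nu,\boldsymbol q,R_0)$. Assume there exist $\theta_{\boldsymbol q}>0$ and $\theta_0>0$ such that $\sum_{k\neq1}q_k\exp(k\theta_{\boldsymbol q})<+\infty$ and $\mathbb E_{R_0}[\exp(\theta_0M(\mathbb T^d))]<+\infty$. Then there exists $\bar\kappa>0$ such that $$\mathbb E_R\Big[\exp\Big(\bar\kappa\sup_{t\in[0,1]}M_t(\mathbb T^d)\Big)\Big]<+\infty.$$ In particular, for all $P\in\mathcal P(\Omega)$ such that $H(P|R)<+\infty$, the map $t\in[0,1]\mapsto\mathbb E_P[M_t]\in\mathcal M_+(\mathbb T^d)$ is well defined and weakly càdlàg. Moreover $$\sup_{t\in[0,1]}\mathbb E_P[M_t(\mathbb T^d)]\le C\big(1+H(P|R)\big),$$ where $C>0$ only depends on $R_0$ and $\boldsymbol q$.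
   Context: $\mathbb T^d$ is the flat torus; $\mathcal M_+(\mathbb T^d)$: finite nonnegative Borel measures with weak convergence; $\mathcal M_\delta(\mathbb T^d)$: finite sums of unit Dirac masses (including $0$). $\Omega$: Skorokhod space of càdlàg curves $[0,1]\to\mathcal M_+(\mathbb T^d)$, canonical process $(M_t)$. $M$ is the identity map on $\mathcal M_+(\mathbb T^d)$. $\mathbb E_P[M_t]$ is the measure $A\mapsto\mathbb E_P[M_t(A)]$. $H(P|R)=\mathbb E_P[\log\frac{dP}{dR}]$ if $P\ll R$, else $+\infty$. A branching mechanism is $\boldsymbol q=(q_k)_{k\in\mathbb N}$ ($\mathbb N=\{0,1,\dots\}$), $q_k\ge0$, $q_1=0$, $\sum_kq_k<\infty$, $\sum_kkq_k<\infty$; $\lambda_{\boldsymbol q}=\sum_kq_k$. $\mathrm{BBM}(\nu,\boldsymbol q,R_0)\in\mathcal P(\Omega)$ is the law of the empirical measure ($M_t$ = sum of Dirac masses at the positions of particles alive at $t$) of the particle system with $M_0\sim R_0$, in which particles move as independent Brownian motions with generator $\frac\nu2\Delta$, live independent exponential times of parameter $\lambda_{\boldsymbol q}$, and at death are replaced on the spot by $k$ particles with probability $q_k/\lambda_{\boldsymbol q}$, evolving independently in the same way. *)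

(* Defs.v *)
From HB Require Import structures.
From mathcomp Require Import all_boot all_order all_algebra.
From mathcomp Require Import generic_quotient.
From mathcomp Require Import all_classical all_reals all_analysis.
From mathcomp Require Import measurable_realfun.

Set Implicit Arguments.
Unset Strict Implicit.
Unset Printing Implicit Defensive.

Import Order.TTheory GRing.Theory Num.Theory.
Import numFieldNormedType.Exports.

Local Open Scope classical_set_scope.
Local Open Scope ring_scope.

Notation borel T := (g_sigma_algebraType (@open T)).

(* The flat torus is R^d / Z^d. *)
Section torus.
Context (R : realType) (d : nat).

Definition lattice_eq : rel 'rV[R]_d :=
  fun x y => [forall j, y 0 j - x 0 j \is a Num.int].

Lemma lattice_eq_refl : reflexive lattice_eq.
Proof. by move=> x; apply/forallP => j; rewrite subrr rpred0. Qed.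

Lemma lattice_eq_sym : symmetric lattice_eq.
Proof. by move=> x y; apply: eq_forallb => j; rewrite -rpredN opprB. Qed.

Lemma lattice_eq_trans : transitive lattice_eq.
Proof.
move=> y x z /forallP xy /forallP yz; apply/forallP => j.
by rewrite -(subrKA (y 0 j)) rpredD.
Qed.

Canonical lattice_equiv :=
  EquivRel lattice_eq lattice_eq_refl lattice_eq_sym lattice_eq_trans.

Definition torus := quotient_topology {eq_quot lattice_eq}%qT.

HB.instance Definition _ := Topological.on torus.

Definition to_torus (x : 'rV[R]_d) : torus := \pi_({eq_quot lattice_eq}%qT)%qT x.

HB.instance Definition _ := isPointed.Build torus (to_torus 0).

End torus.

Section finite_measures.
Context (R : realType) (d : nat).

(* Two elements of [fmeas] may differ outside of the Borel sets; such elements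
   are topologically indistinguishable. *)
Definition fmeas : Type := {finite_measure set (borel (torus R d)) -> \bar R}.

Definition fmeas_fun (m : fmeas) : {finite_measure set (borel (torus R d)) -> \bar R} := m.
Coercion fmeas_fun : fmeas >-> FiniteMeasure.type.

HB.instance Definition _ := gen_eqMixin fmeas.
HB.instance Definition _ := gen_choiceMixin fmeas.
HB.instance Definition _ := isPointed.Build fmeas
  (mzero : {finite_measure set (borel (torus R d)) -> \bar R}).

Definition pairing (f : torus R d -> R) (m : fmeas) : R :=
  (\int[m]_(x in [set: borel (torus R d)]) f x)%R.

HB.instance Definition _ := @isSubBaseTopological.Build fmeas
  ((torus R d -> R) * set R)%type
  [set fU | continuous fU.1 /\ open fU.2]
  (fun fU => pairing fU.1 @^-1` fU.2).

Definition point_configuration (m : fmeas) :=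
  exists s : seq (torus R d), forall A : set (borel (torus R d)),
    measurable A -> m A = (\sum_(x <- s) \d_(x : borel (torus R d)) A)%E.

End finite_measures.

Section skorokhod.
Context (R : realType) (d : nat).

Definition I01 := set_type `[0 : R, 1].

HB.instance Definition _ := Topological.on I01.

Lemma I01_0_subproof : (0 : R) \in `[0, 1]%classic.
Proof. by rewrite inE /= in_itv /= lexx ler01. Qed.

Definition I01_0 : I01 := SigSub I01_0_subproof.

Definition at_right01 (t : I01) : set_system I01 :=
  within [set s | val t < val s] (nbhs t).

Definition at_left01 (t : I01) : set_system I01 :=
  within [set s | val s < val t] (nbhs t).

(* [at_right01] at 1 and [at_left01] at 0 are trivial filters, along which
   everything converges. *)
Definition cadlag (x : I01 -> fmeas R d) :=
  forall t, x @ at_right01 t --> x t /\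
            exists m : fmeas R d, x @ at_left01 t --> m.

Record Omega := MkOmega {
  path :> I01 -> fmeas R d ;
  path_cadlag : cadlag path }.

HB.instance Definition _ := gen_eqMixin Omega.
HB.instance Definition _ := gen_choiceMixin Omega.

Lemma cadlag_cst (m : fmeas R d) : cadlag (fun=> m).
Proof. by move=> t; split; [|exists m]; exact: cvg_cst. Qed.

HB.instance Definition _ := isPointed.Build Omega (MkOmega (cadlag_cst point)).

(* An increasing bijection of [0, 1] is a homeomorphism. *)
Definition time_change (l : I01 -> I01) :=
  bijective l /\ (forall s t, (val (l s) <= val (l t)) = (val s <= val t)).

(* Basic neighborhoods of the J1 topology. The weak topology is generated by
   the pseudometrics (m, m') |-> `|pairing f m - pairing f m'|, f continuous;
   the J1 topology of a completely regular state space is built from finite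
   families of such pseudometrics in the same way as it is built from the
   distance of a metric state space (Jakubowski, 1986), and only depends on
   the topology of the state space. *)
Definition J1_ball (x : Omega) n (f : 'I_n -> torus R d -> R) (e : R) :
    set Omega :=
  [set y | exists l, [/\ time_change l,
     forall t, `|val (l t) - val t| < e &
     forall i t, `|pairing (f i) (x t) - pairing (f i) (y (l t))| < e]].

Definition J1_open : set_system Omega :=
  [set U | forall x, U x -> exists n (f : 'I_n -> torus R d -> R) (e : R),
    [/\ 0 < e, forall i, continuous (f i) & J1_ball x f e `<=` U]].

Lemma J1_openT : J1_open setT.
Proof.
move=> x _; exists 0%N, (fun i => fun=> 0), 1.
by split; [exact: ltr01|move=> i; exact: cst_continuous|].
Qed.

Lemma J1_openI : setI_closed J1_open.
Proof.
move=> U V oU oV x [Ux Vx].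
have [n [f [e [e0 cf fU]]]] := oU _ Ux.
have [m [g [h [h0 cg gV]]]] := oV _ Vx.
exists (n + m)%N,
  (fun i => match fintype.split i with inl j => f j | inr j => g j end),
  (Num.min e h).
split; first by rewrite lt_min e0.
  by move=> i; case: fintype.split.
move=> y [l [tl le lfg]]; split; [apply: fU|apply: gV]; exists l; split=> //.
- by move=> t; have := le t; rewrite lt_min => /andP[].
- move=> i t; have := lfg (lshift m i) t.
  by rewrite (unsplitK (inl i)) lt_min => /andP[].
- by move=> t; have := le t; rewrite lt_min => /andP[].
- move=> i t; have := lfg (rshift n i) t.
  by rewrite (unsplitK (inr i)) lt_min => /andP[].
Qed.

Lemma J1_open_bigU (I : Type) (U : I -> set Omega) :
  (forall i, J1_open (U i)) -> J1_open (\bigcup_i U i).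
Proof.
move=> oU x [i _ Uix]; have [n [f [e [e0 cf fU]]]] := oU i x Uix.
by exists n, f, e; split=> // y /fU ?; exists i.
Qed.

HB.instance Definition _ :=
  isOpenTopological.Build Omega J1_openT J1_openI J1_open_bigU.

Definition sup_mass (w : Omega) : \bar R :=
  ereal_sup (range (fun t : I01 => w t [set: borel (torus R d)])).

Definition mean_measure (P : probability (borel Omega) R) (t : I01)
    (A : set (borel (torus R d))) : \bar R :=
  (\int[P]_(w in [set: borel Omega]) (w : Omega) t A)%E.

End skorokhod.

Section entropy.
Local Open Scope charge_scope.

Definition entropy {disp} {T : measurableType disp} {R : realType}
    (P Q : probability T R) : \bar R :=
  if `[< P `<< Q >] then
    (\int[P]_w lne ('d (charge_of_finite_measure P) '/d Q w))%E
  else +oo%E.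

End entropy.

Section probability.
Context {disp} {W : measurableType disp} {R : realType}.
Variable Pr : probability W R.

Definition independent (I : Type) (G : I -> set_system W) :=
  forall n (J : 'I_n -> I) (E : 'I_n -> set W), injective J ->
    (forall k, G (J k) (E k)) ->
    fine (Pr (\bigcap_k E k)) = \prod_k fine (Pr (E k)).

Definition sigma_of (I : Type) {disp'} {T : measurableType disp'}
    (X : I -> W -> T) : set_system W :=
  <<s \bigcup_i preimage_set_system setT (X i) measurable >>.

(* One-dimensional Brownian motion with variance [nu * t] at time t, i.e. with
   generator f |-> nu / 2 f'', started from 0. Only nonnegative times matter. *)
Definition brownian (nu : R) (B : R -> W -> R) :=
  [/\ forall t, 0 <= t -> measurable_fun setT (B t),
      forall w, B 0 w = 0,
      forall w, {within `[0, +oo[, continuous (B ^~ w)},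
      forall s t, 0 <= s < t -> forall A, measurable A ->
        Pr ((B t \- B s) @^-1` A) = normal_prob 0 (Num.sqrt (nu * (t - s))) A &
      forall t : nat -> R, 0 <= t 0%N -> {homo t : m n / (m <= n)%N >-> m <= n} ->
        independent (fun k : nat =>
          preimage_set_system setT (B (t k.+1) \- B (t k)) measurable)].

End probability.

Section branching.
Context (R : realType) (d : nat).

Definition branching_mechanism (q : nat -> R) :=
  [/\ forall k, 0 <= q k, q 1%N = 0, cvgn (series q) &
      cvgn (series (fun k => k%:R * q k))].

Definition branching_rate (q : nat -> R) : R := limn (series q).

(* [(i, v)] is the particle reached from the [i]-th initial particle through
   the child indices in [v], the most recent one being at the head of [v]. *)
Definition label : Type := (nat * seq nat)%type.

(* Initial positions are given by lifts to
   R^d, which is no restriction since the projection to the torus has a Borel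
   section. A lifetime may be infinite (when the branching rate is 0). *)
Record particle_data (W : Type) := ParticleData {
  init_number : W -> nat ;
  init_position : nat * 'I_d -> W -> R ;
  lifetime : label -> W -> \bar R ;
  offspring : label -> W -> nat ;
  motion : label -> 'I_d -> R -> W -> R }.

Section system.
Context (W : Type) (D : particle_data W) (w : W).

Fixpoint in_tree (i : nat) (v : seq nat) : bool :=
  match v with
  | [::] => (i < init_number D w)%N
  | k :: v' => in_tree i v' && (k < offspring D (i, v') w)%N
  end.

Fixpoint birth (i : nat) (v : seq nat) : \bar R :=
  match v with
  | [::] => 0%E
  | _ :: v' => (birth i v' + lifetime D (i, v') w)%E
  end.

Definition displacement (u : label) (t : R) : 'rV[R]_d :=
  \row_j motion D u j t w.

Fixpoint birth_place (i : nat) (v : seq nat) : 'rV[R]_d :=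
  match v with
  | [::] => \row_j init_position D (i, j) w
  | _ :: v' => birth_place i v' +
                displacement (i, v') (fine (lifetime D (i, v') w))
  end.

Definition alive (t : R) : set label :=
  [set u | in_tree u.1 u.2 /\
    (birth u.1 u.2 <= t%:E < birth u.1 u.2 + lifetime D u w)%E].

Definition position (u : label) (t : R) : torus R d :=
  to_torus (birth_place u.1 u.2 + displacement u (t - fine (birth u.1 u.2))).

Definition empirical_measure (t : R) (A : set (borel (torus R d))) : \bar R :=
  (\esum_(u in alive t) \d_(position u t : borel (torus R d)) A)%E.

End system.

Inductive source : Type :=
| Initial
| Clock of label
| Offspring of label
| Motion of label & 'I_d.

Definition source_algebra {disp} {W : measurableType disp}
    (D : particle_data W) (s : source) : set_system W :=
  match s with
  | Initial => <<s sigma_of (fun _ : unit => init_number D)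
                   `|` sigma_of (init_position D) >>
  | Clock u => sigma_of (fun _ : unit => lifetime D u)
  | Offspring u => sigma_of (fun _ : unit => offspring D u)
  | Motion u j => sigma_of (fun t : {t : R | 0 <= t} => motion D u j (sval t))
  end.

(* With branching rate 0 the lifetimes are almost surely infinite and the
   offspring numbers are irrelevant. *)
Definition branching_system {disp} {W : measurableType disp}
    (Pr : probability W R) (nu : R) (q : nat -> R) (D : particle_data W) :=
  [/\ measurable_fun setT (init_number D) /\
        (forall ij, measurable_fun setT (init_position D ij)),
      forall u, measurable_fun setT (lifetime D u) /\
        (forall t, 0 <= t -> Pr [set w | (t%:E < lifetime D u w)%E] =
           (expR (- (branching_rate q * t)))%:E),
      forall u, measurable_fun setT (offspring D u) /\
        (0 < branching_rate q -> forall k,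
           Pr [set w | offspring D u w = k] = (q k / branching_rate q)%:E),
      forall u j, brownian Pr nu (motion D u j) &
      independent Pr (source_algebra D)].

(* The equality between [X] and the empirical measure is only almost sure:
   on a null event the empirical measure may explode or fail to be cadlag. *)
Definition is_BBM (nu : R) (q : nat -> R) (R0 : probability (borel (fmeas R d)) R)
    (Q : probability (borel (Omega R d)) R) :=
  exists disp (W : measurableType disp) (Pr : probability W R)
    (D : particle_data W) (X : W -> borel (Omega R d)),
  [/\ branching_system Pr nu q D,
      measurable_fun setT X,
      {ae Pr, forall w, forall (t : I01 R) (A : set (borel (torus R d))),
        measurable A -> (X w : Omega R d) t A = empirical_measure D w (val t) A},
      forall A : set (borel (fmeas R d)), measurable A ->
        Pr [set w | A ((X w : Omega R d) (I01_0 R))] = R0 A &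
      forall A, measurable A -> Pr (X @^-1` A) = Q A].

End branching.

(* Main.v *)
Require Import Defs.
From HB Require Import structures.
From mathcomp Require Import all_boot all_order all_algebra.
From mathcomp Require Import generic_quotient.
From mathcomp Require Import all_classical all_reals all_analysis.
From mathcomp Require Import measurable_realfun ring lra.

Set Implicit Arguments.
Unset Strict Implicit.
Unset Printing Implicit Defensive.

Import Order.TTheory GRing.Theory Num.Theory.
Import numFieldNormedType.Exports.

Local Open Scope classical_set_scope.
Local Open Scope ring_scope.

(** Everything rests on [exponential_moment]: for some [kappa > 0], the expectation
of [expR (kappa * sup_mass)] is bounded by a constant that depends only on [q] and
on [R0].

Call a particle short-lived if its lifetime is at most [s], and give each particle
the weight [eps ^+ n], where [n] counts its long-lived ancestors. A particle born
before time 1 has at most [K] long-lived ancestors, [K] being the integral part of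
[1 / s]; so [eps ^+ K] times the number of particles ever born before time 1, and
a fortiori [eps ^+ K] times the mass at any time, is at most the total weight of
the genealogical trees, in which time no longer appears. The total weight of the
tree of one particle satisfies [T = 1 + x * (T_1 + ... + T_k)], where [k] is the
offspring number, [x] is 1 or [eps] according to the lifetime, and the [T_i] are
independent copies of [T]. By convexity
[[ expR (c * T) <= expR c * (1 + x * \prod_(i < k) expR (c * T_i)), ]]
and by independence a bound [m] for the expectation of the left-hand side, for
the tree cut at generation [n], yields the bound [expR c * (1 + E[x] * phi(m))] at
generation [n + 1], where [phi] is the generating function of the offspring law.
Now [phi(m)] is finite for [m = expR theta] and small [theta], and [E[x]] is as
small as desired if [s] and [eps] are: the bound [m] propagates through the
generations ([integral_prod_progeny_exp]). Starting from [N] particles gives [m ^+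
N], which is integrable if [theta] is at most the exponent given for [R0]
([integral_forest]). The pathwise comparison is [expeR_count_alive].

If the entropy of [P] with respect to [Q] is finite, the Gibbs variational
inequality [entropy_gibbs] turns the exponential moment into the bound of the
theorem, already for the expectation of the supremum of the mass. The supremum is
therefore integrable under [P]; it dominates the pairing with any bounded test
function, and the one-sided limits of the paths pass to the means by dominated
convergence ([mean_path_cadlag]).

The evaluation of a path at a fixed time is a Borel function of the path although
it is not continuous for the J1 topology: the supremum of a continuous functional
over an open interval of times is lower semicontinuous, and the value at a time is
the limit of such suprema over intervals that shrink to it from the right
([measurable_pairing_at]). *)

(** * The Gibbs variational inequality *)

Section gibbs.
Local Open Scope ereal_scope.

Lemma measurable_expeR (R : realType) :
  measurable_fun [set: \bar R] (@expeR R).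
Proof.
rewrite (_ : @expeR R = fun x => maxe 0 (er_map (@expR R) x)).
  apply: measurable_maxe; first exact: measurable_cst.
  by apply: (@measurable_er_map _ R); exact: measurable_expR.
apply/funext => -[r| |].
- by rewrite /maxe /= lte_fin expR_gt0.
- by rewrite /maxe /= ltry.
- by rewrite /maxe.
Qed.

Lemma measurable_lne (R : realType) : measurable_fun [set: \bar R] (@lne R).
Proof.
rewrite (_ : @lne R = fun x => if x <= 0 then -oo else er_map (@ln R) x).
  apply: measurable_fun_ifT; first exact: measurable_fun_lee.
    exact: measurable_cst.
  by apply: (@measurable_er_map _ R); exact: measurable_ln.
by apply/funext => -[r| |] //=; case: ifP.
Qed.

Lemma integral_cst_prob d (T : measurableType d) (R : realType)
  (P : probability T R) (c : \bar R) : \int[P]_x cst c x = c.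
Proof.
rewrite integral_cst// -[RHS]mule1; congr (_ * _); exact: probability_setT.
Qed.

(** This is [ln z <= z - 1] at [z = e^y / (rho K)], arranged so that every term is
    nonnegative and can be integrated separately. *)
Lemma gibbs_pointwise (R : realType) (rho K : R) (y : \bar R) :
  (0 < rho)%R -> (1 <= K)%R -> 0 <= y ->
  y + maxe (- lne rho%:E) 0 + 1 <=
    maxe (lne rho%:E) 0 + (ln K)%:E + K^-1%:E * (expeR y * rho^-1%:E).
Proof.
move=> r0 K1; have K0 : (0 < K)%R by exact: lt_le_trans K1.
rewrite lne_EFin// -EFinN -!EFin_max.
case: y => [y| |] // y0; last first.
  rewrite (gt0_mulye (x := rho^-1%:E)) ?lte_fin ?invr_gt0//.
  by rewrite gt0_muley ?lte_fin ?invr_gt0// -EFinD addey// leey.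
rewrite /= -!EFinM -!EFinD lee_fin.
have z0 : (0 < expR y / (rho * K))%R by rewrite divr_gt0 ?expR_gt0 ?mulr_gt0.
have : (ln (expR y / (rho * K)) <= expR y / (rho * K) - 1)%R.
  by rewrite -[X in ln X](subrKC 1) le_ln1Dx// ltrBrDl subrr.
rewrite ln_div ?posrE ?expR_gt0 ?mulr_gt0// expRK lnM ?posrE//.
have -> : (K^-1 * (expR y / rho) = expR y / (rho * K))%R.
  by field; rewrite !gt_eqF.
have -> : (Num.max (ln rho) 0 = ln rho + Num.max (- ln rho) 0)%R.
  by rewrite !maxr_absE !subr0 normrN; lra.
lra.
Qed.

(** Integrating [gibbs_pointwise] against [P], with [rho] the density of [P] with
    respect to [Q]: the last term contributes at most
    [K^-1 * \int[Q] expeR Y <= 1], which cancels the constant 1. *)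
Lemma entropy_gibbs disp (T : measurableType disp) (R : realType)
    (P Q : probability T R) (Y : T -> \bar R) (K : R) : entropy P Q < +oo ->
  measurable_fun setT Y -> (forall x, 0 <= Y x) -> (1 <= K)%R ->
  \int[Q]_x expeR (Y x) <= K%:E ->
  \int[P]_x Y x <= entropy P Q + (ln K)%:E.
Proof.
rewrite /entropy; case: asboolP => // PQ Hfin mY Y0 K1 HK.
have K0 : (0 < K)%R by exact: lt_le_trans K1.
set r := Radon_Nikodym _ Q in Hfin *.
pose rs := Radon_Nikodym_SigmaFinite.f P Q.
have rs0 x : 0 <= rs x by exact: Radon_Nikodym_SigmaFinite.f_ge0.
have rsfin x : rs x \is a fin_num by exact: Radon_Nikodym_SigmaFinite.f_fin_num.
have mrs : measurable_fun setT rs.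
  by apply: measurable_int; exact: Radon_Nikodym_SigmaFinite.f_integrable.
have mr : measurable_fun setT r.
  by apply: measurable_int; exact: Radon_Nikodym_integrable.
have mlrs : measurable_fun setT (fun x => lne (rs x)).
  exact: measurableT_comp (@measurable_lne R) mrs.
have rE : \int[P]_x lne (r x) = \int[P]_x lne (rs x).
  apply: ae_eq_integral => //.
    exact: measurableT_comp (@measurable_lne R) mr.
  have /(null_dominates_ae_eq measurableT PQ) : ae_eq Q setT rs r.
    exact: ae_eq_Radon_Nikodym_SigmaFinite.
  by apply: filterS => x /= + _ => ->.
rewrite rE in Hfin *.
(* The inverse of the density; where the density vanishes it is 1, a value that is
   multiplied by 0 below. *)
pose ir x := expR (- ln (fine (rs x))).
have irE x : (0 < fine (rs x))%R -> ir x = (fine (rs x))^-1%R.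
  by move=> ?; rewrite /ir expRN lnK.
have minv : measurable_fun setT (fun x => (ir x)%:E).
  apply/measurable_EFinP; apply: measurableT_comp => //.
  apply: measurable_funN; apply: measurableT_comp => //.
  exact: measurableT_comp (@fine_measurable _ _ measurableT) mrs.
have chg f : measurable_fun setT f -> (forall x, 0 <= f x) ->
    \int[P]_x (f x * (ir x)%:E) <= \int[Q]_x f x.
  move=> mf f0.
  have inv0 x : 0 <= f x * (ir x)%:E.
    by rewrite mule_ge0// lee_fin expR_ge0.
  have mfi : measurable_fun setT (fun x => f x * (ir x)%:E).
    exact: emeasurable_funM.
  rewrite -(Radon_Nikodym_SigmaFinite.change_of_variables PQ)//.
  apply: ge0_le_integral => //.
  - by move=> x _; rewrite mule_ge0.
  - exact: emeasurable_funM.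
  - move=> x _; rewrite -/rs -(fineK (rsfin x)) -muleA -EFinM.
    have [rx|rx] := ltP 0%R (fine (rs x)).
      by rewrite irE// mulVf ?mule1// gt_eqF.
    have -> : fine (rs x) = 0%R by apply/eqP; rewrite eq_le rx fine_ge0.
    by rewrite mulr0 mule0.
have rspos : {ae P, forall x, (0 < fine (rs x))%R}.
  exists (rs @^-1` [set 0]); split.
  - by rewrite -[X in measurable X]setTI; exact: mrs.
  - rewrite (Radon_Nikodym_SigmaFinite.f_integral PQ); last first.
      by rewrite -[X in measurable X]setTI; exact: mrs.
    by rewrite integral0_eq.
  - move=> x /= /negP; rewrite -leNgt => le0; apply/eqP.
    by rewrite eq_le rs0 andbT -(fineK (rsfin x)) lee_fin.
have mpos : measurable_fun setT (fun x => maxe (lne (rs x)) 0).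
  by apply: measurable_maxe.
have mneg : measurable_fun setT (fun x => maxe (- lne (rs x)) 0).
  by apply: measurable_maxe => //; exact: measurableT_comp.
have mexp : measurable_fun setT (fun x => expeR (Y x)).
  exact: measurableT_comp (@measurable_expeR R) mY.
have pos0 x : 0 <= maxe (lne (rs x)) 0 by rewrite le_max lexx orbT.
have neg0 x : 0 <= maxe (- lne (rs x)) 0 by rewrite le_max lexx orbT.
have lnK0 : (0 <= ln K)%R by exact: ln_ge0.
have main : \int[P]_x Y x + \int[P]_x maxe (- lne (rs x)) 0 + 1 <=
    \int[P]_x maxe (lne (rs x)) 0 + (ln K)%:E + 1.
  have K10 : 0 <= K^-1%:E by rewrite lee_fin invr_ge0 ltW.
  have mlast : measurable_fun setT (fun x => K^-1%:E * (expeR (Y x) * (ir x)%:E)).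
    by apply: emeasurable_funM => //; apply: emeasurable_funM.
  rewrite -[in leLHS](integral_cst_prob P 1).
  rewrite -[in leRHS](integral_cst_prob P (ln K)%:E).
  have Yneg0 x : [set: T] x -> 0 <= Y x + maxe (- lne (rs x)) 0.
    by rewrite adde_ge0.
  have mYneg : measurable_fun setT (fun x => Y x + maxe (- lne (rs x)) 0).
    exact: emeasurable_funD.
  have posK0 x : [set: T] x -> 0 <= maxe (lne (rs x)) 0 + cst (ln K)%:E x.
    by rewrite adde_ge0.
  have mposK : measurable_fun setT (fun x => maxe (lne (rs x)) 0 + cst (ln K)%:E x).
    exact: emeasurable_funD.
  have last0 x : [set: T] x -> 0 <= K^-1%:E * (expeR (Y x) * (ir x)%:E).
    by rewrite !mule_ge0// ?expeR_ge0// lee_fin expR_ge0.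
  rewrite -!ge0_integralD//.
  apply: (@le_trans _ _ (\int[P]_x (maxe (lne (rs x)) 0 + cst (ln K)%:E x +
      K^-1%:E * (expeR (Y x) * (ir x)%:E)))).
    apply: ae_ge0_le_integral => //.
    - by move=> x _; rewrite !adde_ge0.
    - exact: emeasurable_funD.
    - by move=> x _; rewrite adde_ge0// ?posK0 ?last0.
    - exact: emeasurable_funD.
    - apply: filterS rspos => x rx _.
      by rewrite irE// -(fineK (rsfin x)); exact: gibbs_pointwise.
  rewrite [leLHS]ge0_integralD//.
  rewrite ge0_integralZl//; last 2 first.
  - exact: emeasurable_funM.
  - by move=> x _; rewrite mule_ge0// ?expeR_ge0// lee_fin expR_ge0.
  rewrite leeD2l//; apply: (@le_trans _ _ (K^-1%:E * K%:E)); last first.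
    by rewrite -EFinM mulVf// gt_eqF.
  rewrite lee_wpmul2l//; apply: le_trans HK; apply: chg => // x.
  exact: expeR_ge0.
have negfin : \int[P]_x maxe (- lne (rs x)) 0 \is a fin_num.
  rewrite ge0_fin_numE ?integral_ge0//.
  apply: (@le_lt_trans _ _ 1); last by rewrite ltry.
  apply: (@le_trans _ _ (\int[P]_x (cst 1 x * (ir x)%:E))).
    apply: ae_ge0_le_integral => //.
    - by move=> x _; rewrite mul1e lee_fin expR_ge0.
    - exact: emeasurable_funM.
    apply: filterS rspos => x rx _.
    rewrite -(fineK (rsfin x)) lne_EFin// mul1e -EFinN -EFin_max lee_fin.
    rewrite ge_max expR_ge0 andbT /ir.
    by apply: le_trans (expR_ge1Dx _); rewrite lerDr.
  apply: le_trans (chg _ _ _) _ => //.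
  by rewrite integral_cst_prob.
move: main Hfin; rewrite leeD2rE// => main.
rewrite [in leRHS]integralE funepos.unlock funeneg.unlock => _.
by rewrite addeAC leeBrDr.
Qed.

Lemma entropy_ge0 disp (T : measurableType disp) (R : realType)
  (P Q : probability T R) : 0 <= entropy P Q.
Proof.
have [->|fin] := eqVneq (entropy P Q) +oo; first by [].
have := @entropy_gibbs _ T R P Q (cst 0) 1.
by rewrite ltey fin ln1 adde0 !integral_cst_prob expR0; apply.
Qed.

End gibbs.

(** * The torus *)

Lemma lsc_measurable (R : realType) (T : ptopologicalType) (f : T -> \bar R) :
  (forall c : R, open [set x | (c%:E < f x)%E]) ->
  measurable_fun [set: borel T] (f : borel T -> \bar R).
Proof.
move=> fo mD; apply: (measurability _ (ErealGenOInfty.measurableE R)) => //.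
move=> _ [_ [r ->] <-]; rewrite setTI; apply: sub_sigma_algebra.
rewrite (_ : _ @^-1` _ = [set x | (r%:E < f x)%E]); first exact: fo.
by apply/seteqP; split=> x /=; rewrite in_itv /= andbT.
Qed.

Lemma continuous_borel_measurable (R : realType) (T : ptopologicalType)
    (f : T -> R) :
  continuous f -> measurable_fun [set: borel T] (f : borel T -> R).
Proof.
move=> /continuousP cf; apply/measurable_EFinP; apply: lsc_measurable => c.
rewrite (_ : [set _ | _] = f @^-1` [set y | c < y]); first exact/cf/open_gt.
by apply/seteqP; split=> x /=; rewrite lte_fin.
Qed.

Lemma to_torusP (R : realType) (d : nat) (x y : 'rV[R]_d) :
  reflect (to_torus x = to_torus y) (lattice_eq x y).
Proof. exact: (@eqmodP _ (lattice_equiv R d)). Qed.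

Lemma to_torus_repr (R : realType) (d : nat) (x : torus R d) :
  to_torus (repr x) = x.
Proof. exact: reprK. Qed.

Lemma to_torus_continuous (R : realType) (d : nat) : continuous (@to_torus R d).
Proof. exact: quotient_topology.pi_continuous. Qed.

(** The torus is the image of the compact cube [[0, 1]^d]. *)
Lemma torus_bounded (R : realType) (d : nat) (f : torus R d -> R) :
  continuous f -> exists2 M, 0 < M & forall x, `|f x| <= M.
Proof.
move=> cf.
have : compact [set v : 'rV[R]_d | forall i, `[0, 1]%classic (v ord0 i)].
  apply: (rV_compact (T := R) (A := fun=> `[0, 1]%classic)) => i.
  exact: segment_compact.
set K := [set v | _] => cK.
have tK : @to_torus R d @` K = setT.
  apply/seteqP; split=> // x _.
  exists (\row_j (repr x 0 j - (Num.floor (repr x 0 j))%:~R)).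
    move=> i /=; rewrite mxE in_itv/= subr_ge0 ge_floor lerBlDr addrC.
    by rewrite -[X in _ + X]/(1%:~R) -intrD ltW// floorD1_gt.
  rewrite -[RHS]to_torus_repr; apply/to_torusP/forallP => j.
  by rewrite mxE opprB addrC subrK intr_int.
have : compact (f @` [set: torus R d]).
  rewrite -tK image_comp.
  apply: (@continuous_compact _ _ (f \o @to_torus R d) K) cK.
  apply: continuous_subspaceT => x; apply: continuous_comp; last exact: cf.
  exact: to_torus_continuous.
move=> /compact_bounded [M [_ HM]]; exists (`|M| + 1); first by rewrite ltr_wpDl.
by move=> x; apply: (HM (`|M| + 1)); [rewrite ltr_pwDr// ler_norm|exists x].
Qed.

Section dist_to_set.
Context {R : realType} {V : normedModType R}.
Implicit Types (C : set V) (x y : V).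

Definition dist_to (C : set V) (x : V) : R := inf [set `|x - a| | a in C].

Lemma dist_to_has_inf C x : C !=set0 -> has_inf [set `|x - a| | a in C].
Proof.
move=> [a Ca]; split; first by exists `|x - a|, a.
by exists 0 => _ [b _ <-].
Qed.

Lemma dist_to_ge0 C x : C !=set0 -> 0 <= dist_to C x.
Proof.
by move=> C0; apply: lb_le_inf; [exact: (dist_to_has_inf _ C0).1|move=> _ [b _ <-]].
Qed.

Lemma dist_to_le C x a : C a -> dist_to C x <= `|x - a|.
Proof.
by move=> Ca; apply: ge_inf; [exact: (dist_to_has_inf x (ex_intro _ a Ca)).2|exists a].
Qed.

Lemma dist_to_triangle C x y : C !=set0 -> dist_to C x <= `|x - y| + dist_to C y.
Proof.
move=> C0; rewrite addrC -lerBlDr; apply: lb_le_inf.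
  exact: (dist_to_has_inf _ C0).1.
move=> _ [a Ca <-]; rewrite lerBlDr (le_trans (dist_to_le x Ca))//.
by rewrite [leRHS]addrC ler_distD.
Qed.

Lemma dist_to_continuous C : C !=set0 -> continuous (dist_to C).
Proof.
move=> C0 x; apply/cvgrPdist_lt => e e0.
have /cvgrPdist_lt/(_ e e0) : (y : V) @[y --> x] --> x by exact: cvg_id.
apply: filterS => y; apply: le_lt_trans.
rewrite ler_norml lerBlDr (dist_to_triangle _ _ C0) andbT lerBrDl lerBlDr.
by rewrite addrC distrC dist_to_triangle.
Qed.

Lemma dist_to_gt0 C x : C !=set0 -> closed C -> ~ C x -> 0 < dist_to C x.
Proof.
move=> C0 Cc Cx.
have : nbhs x (~` C) by apply: open_nbhs_nbhs; split => //; exact: closed_openC.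
move=> /nbhs_ballP[e /= e0 eC]; apply: (lt_le_trans e0).
apply: lb_le_inf; first exact: (dist_to_has_inf _ C0).1.
move=> _ [a Ca <-]; rewrite leNgt; apply/negP => xa.
by apply: (eC a) => //; rewrite -ball_normE.
Qed.

End dist_to_set.

(** The distance to the complement of the preimage of [U] in [R^d] is invariant
    under the lattice, so it descends to the torus. *)
Lemma torus_open_cozero (R : realType) (d : nat) (U : set (torus R d)) : open U ->
  exists g : torus R d -> R, [/\ continuous g, forall x, 0 <= g x &
    forall x, U x <-> 0 < g x].
Proof.
move=> oU; pose C := ~` (@to_torus R d @^-1` U).
have [CN0|/set0P C0] := eqVneq C set0.
  exists (cst 1); split; [exact: cst_continuous|by move=> x|move=> x].
  split=> [//|_]; have : ~ C (repr x) by rewrite CN0.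
  by rewrite /C /= => /contrapT; rewrite to_torus_repr.
have Cinv (v w : 'rV[R]_d) : to_torus v = to_torus w -> dist_to C v = dist_to C w.
  have le u u' : to_torus u = to_torus u' -> dist_to C u <= dist_to C u'.
    move=> uu'; apply: lb_le_inf; first exact: (dist_to_has_inf _ C0).1.
    move=> _ [a Ca <-].
    have -> : u' - a = u - (u - u' + a) by rewrite opprD opprB addrA subrKC.
    apply: dist_to_le; rewrite /C /= (_ : to_torus _ = to_torus a)//.
    apply/to_torusP/forallP => j; rewrite !mxE.
    move: uu' => /to_torusP/forallP /(_ j).
    by rewrite opprD addrCA subrr addr0 opprB.
  by move=> vw; apply/le_anti; rewrite !le.
exists (fun x => dist_to C (repr x)); split.
- apply: (quotient_topology.repr_comp_continuous (g := dist_to C)).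
    exact: dist_to_continuous.
  by move=> a b /eqP ab; apply/eqP; exact: Cinv.
- by move=> x; exact: dist_to_ge0.
- move=> x; rewrite -[in U x](to_torus_repr x); split.
    move=> Ux; apply: dist_to_gt0 => //.
    rewrite closedC; have /continuousP := @to_torus_continuous R d; exact.
  move=> gx; apply: contrapT => nU; move: gx.
  have CX : C (repr x) by [].
  apply/negP; rewrite -leNgt; have := dist_to_le (repr x) CX.
  by rewrite subrr normr0.
Qed.

(** * Finite measures on the torus *)

Lemma integrable_continuous (R : realType) (d : nat) (m : fmeas R d)
    (f : torus R d -> R) : continuous f ->
  m.-integrable [set: borel (torus R d)] (EFin \o (f : borel (torus R d) -> R)).
Proof.
move=> cf; have [M M0 fM] := torus_bounded cf.
apply: measurable_bounded_integrable => //.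
- exact: fin_num_fun_lty.
- exact: continuous_borel_measurable.
- exists M; split; first exact: num_real.
  by move=> x /ltW xM t _; exact: le_trans (fM t) xM.
Qed.

Lemma pairingE (R : realType) (d : nat) (m : fmeas R d) (f : torus R d -> R) :
  continuous f ->
  (pairing f m)%:E = (\int[m]_(x in [set: borel (torus R d)]) (f x)%:E)%E.
Proof.
move=> cf; rewrite /pairing /Rintegral fineK// integrable_fin_num//.
exact: integrable_continuous.
Qed.

Lemma pairing_cst1 (R : realType) (d : nat) (m : fmeas R d) :
  (pairing (cst 1) m)%:E = m [set: borel (torus R d)].
Proof.
rewrite pairingE; last exact: cst_continuous.
by rewrite -[RHS]mul1e; exact: (integral_cst m measurableT 1%E).
Qed.

Lemma pairing_continuous (R : realType) (d : nat) (f : torus R d -> R) :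
  continuous f -> continuous (pairing f : fmeas R d -> R).
Proof.
move=> cf; apply/continuousP => U oU.
pose D := [set fU : (torus R d -> R) * set R | continuous fU.1 /\ open fU.2].
have : finI_from D (fun fU => @pairing R d fU.1 @^-1` fU.2) (pairing f @^-1` U).
  by have := @finI_from1 _ _ D (fun fU => @pairing R d fU.1 @^-1` fU.2) (f, U);
    apply.
move=> H; exists [set pairing f @^-1` U]; first by move=> _ ->.
by rewrite bigcup_set1.
Qed.

Lemma fmeas_cvgP (R : realType) (d : nat) (F : set_system (fmeas R d))
    (FF : Filter F) (m : fmeas R d) :
  (forall f : torus R d -> R, continuous f -> pairing f @ F --> pairing f m) ->
  F --> m.
Proof.
move=> H A; rewrite nbhsE => -[B [oB Bm] BA].
apply: filterS BA _.
case: oB Bm => D DI <- [C DC Cm].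
have [E ED CE] := DI _ DC.
apply: (@filterS _ _ _ C); first by move=> x Cx; exists C.
rewrite -CE; apply: filter_bigI => -[f U] fE.
have := ED _ fE; rewrite inE => -[/= cf oU].
apply: (H f cf); apply: open_nbhs_nbhs; split => //.
by move: Cm; rewrite -CE => /(_ (f, U) fE).
Qed.


Lemma monotone_convergence_cvg d (T : measurableType d) (R : realType)
    (mu : {measure set T -> \bar R}) (f_ : nat -> T -> \bar R) (f : T -> \bar R) :
  (forall n, measurable_fun setT (f_ n)) -> (forall n x, (0 <= f_ n x)%E) ->
  (forall x, {homo f_^~ x : n m / (n <= m)%N >-> (n <= m)%E}) ->
  (forall x, f_ n x @[n --> \oo] --> f x) ->
  (\int[mu]_x f_ n x)%E @[n --> \oo] --> (\int[mu]_x f x)%E.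
Proof.
move=> mf f0 nd cf.
have -> : f = (fun x => limn (f_^~ x)).
  by apply/funext => x; apply/esym/cvg_lim.
by apply: cvg_monotone_convergence.
Qed.


(** The functions [min 1 (n g)] increase to the indicator of [[set x | 0 < g x]]. *)
Lemma open_measure_cvg (R : realType) (d : nat) (U : set (torus R d)) : open U ->
  exists f : nat -> torus R d -> R, (forall n, continuous (f n)) /\
    forall m : fmeas R d,
      (pairing (f n) m)%:E @[n --> \oo] --> m (U : set (borel (torus R d))).
Proof.
move=> oU; have [g [cg g0 gU]] := torus_open_cozero oU.
pose f n x := Num.min 1 (n%:R * g x).
have cf n : continuous (f n).
  move=> x; apply: (@continuous_min _ _ (cst 1) (fun x => n%:R * g x)).
    exact: cst_continuous.
  by apply: (@continuousM _ _ (cst n%:R) g); [exact: cst_continuous|exact: cg].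
have mU : measurable (U : set (borel (torus R d))) by exact: sub_sigma_algebra.
exists f; split=> // m.
have -> : m U = (\int[m]_x (\1_(U : set (borel (torus R d))) x)%:E)%E.
  by rewrite integral_indic// setIT.
under eq_fun do rewrite pairingE//.
apply: (@monotone_convergence_cvg _ (borel (torus R d)) _ m).
- by move=> n; apply/measurable_EFinP; exact: continuous_borel_measurable.
- by move=> n x; rewrite lee_fin le_min ler01 mulr_ge0.
- move=> x n k nk; rewrite lee_fin le_min ge_min lexx /= ge_min orbC.
  by rewrite ler_wpM2r// ler_nat.
- move=> x; apply/cvg_EFin; first exact: nearW.
  rewrite /= /comp indicE.
  have [Ux|nUx] := pselect (U x); last first.
    rewrite memNset//; apply: cvg_near_cst; apply: nearW => n.
    have gx0 : g x = 0.
      by apply/eqP; rewrite eq_le g0 andbT leNgt; apply/negP => /gU.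
    by rewrite /f /= gx0 mulr0 minEle ler10.
  rewrite mem_set//; apply: cvg_near_cst.
  have gx : 0 < g x by apply/gU.
  near=> n; rewrite /f /=; apply/min_idPl.
  rewrite -ler_pdivrMr// mul1r; near: n.
  exact: nbhs_infty_ger.
Unshelve. all: by end_near. Qed.

(** The Borel sets for which the claim holds form a Dynkin class, and open sets
    belong to it by [open_measure_cvg]. *)
Lemma measurable_fmeas_family (R : realType) (d : nat) disp
    (W : measurableType disp) (mu : W -> fmeas R d) :
  (forall f : torus R d -> R, continuous f ->
    measurable_fun setT (fun w => pairing f (mu w))) ->
  forall A : set (borel (torus R d)), measurable A ->
    measurable_fun setT (fun w => mu w A).
Proof.
move=> H; apply: (@dynkin_induction _ (borel (torus R d)) (@open (torus R d))
  (fun A => measurable_fun setT (fun w => mu w A))).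
- by [].
- exact: openI.
- under eq_fun do rewrite -pairing_cst1.
  by apply/measurable_EFinP; apply: H; exact: cst_continuous.
- move=> U oU; have [f [cf fU]] := open_measure_cvg oU.
  apply: (emeasurable_fun_cvg (fun n w => (pairing (f n) (mu w))%:E)) => //.
  by move=> n; apply/measurable_EFinP; exact: H.
- move=> S mS HS; rewrite (_ : (fun w => _) = (fun w => mu w setT - mu w S)%E).
    apply: emeasurable_funB => //.
    under eq_fun do rewrite -pairing_cst1.
    by apply/measurable_EFinP; apply: H; exact: cst_continuous.
  apply/funext => w; rewrite -setTD measureD// ?setTI//.
  by rewrite fin_num_fun_lty.
- move=> F mF tF HF; rewrite (_ : (fun w => _) = (fun w => \sum_(n <oo) mu w (F n))%E).
    by apply: ge0_emeasurable_sum => // n w _ _; exact: measure_ge0.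
  by apply/funext => w; rewrite measure_bigcup//; apply: eq_eseriesl => n; rewrite in_setT.
Qed.

(** * Measurability of evaluation on the path space *)

Lemma I01_nbhsP (R : realType) (t : I01 R) (A : set (I01 R)) :
  nbhs t A <-> exists2 e : R, 0 < e & forall s : I01 R, `|val s - val t| < e -> A s.
Proof.
split.
  rewrite nbhsE => -[B [[U oU <-] /= Ut] BA].
  have /nbhs_ballP[e /= e0 eU] : nbhs (val t) U by exact: open_nbhs_nbhs.
  exists e => // s se; apply: BA; apply: eU.
  by rewrite /ball /= distrC.
move=> [e e0 eA]; rewrite nbhsE; exists (val @^-1` (ball (val t) e)).
  split; last exact: ballxx.
  by exists (ball (val t) e) => //; exact: ball_open.
by move=> s; rewrite /= /ball /= distrC => /eA.
Qed.

Lemma I01_val01 (R : realType) (t : I01 R) : 0 <= val t <= 1.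
Proof. by have := valP t; rewrite inE /= in_itv. Qed.

(** Time windows replace fixed times: to exceed a level during an open window is an
    open condition for the J1 topology, to exceed it at a given time is not. *)
Definition hits (R : realType) (d : nat) (S : set (I01 R)) (f : torus R d -> R)
    (c : R) : set (Omega R d) :=
  [set w | exists2 s, S s & c < pairing f (w s)].

(** In a J1 neighborhood of a path, the value at [s] is nearly attained at [l s]
    for some small time change [l]; the hypothesis keeps [l s] in the window. *)
Lemma hits_open (R : realType) (d : nat) (S : set (I01 R)) (f : torus R d -> R)
    (c : R) :
  (forall s, S s -> exists2 e : R, 0 < e & forall l, time_change l ->
     (forall t, `|val (l t) - val t| < e) -> S (l s)) ->
  continuous f -> open (hits S f c).
Proof.
move=> HS cf; suff : J1_open (hits S f c) by [].
move=> w [s Ss cs].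
have [e e0 He] := HS _ Ss.
exists 1%N, (fun=> f), (Num.min e (pairing f (w s) - c)); split => //.
  by rewrite lt_min e0 subr_gt0.
move=> y [l [tl le lf]]; exists (l s).
  by apply: He => // t; apply: lt_le_trans (le t) _; rewrite ge_min lexx.
have := lf ord0 s; rewrite lt_min => /andP[_]; rewrite ltr_norml => /andP[_].
by rewrite ltrD2l ltrN2.
Qed.

Lemma time_change1 (R : realType) (l : I01 R -> I01 R) (t : I01 R) : time_change l ->
  val t = 1 -> val (l t) = 1.
Proof.
move=> [[g lg gl] mono] t1; apply/le_anti.
have /andP[_ ->] := I01_val01 (l t); rewrite -[in leLHS]t1 -{1}(gl t) mono t1.
by have /andP[_ ->] := I01_val01 (g t).
Qed.

Lemma measurable_hits (R : realType) (d : nat) (S : set (I01 R))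
    (f : torus R d -> R) (c : R) :
  (forall s, S s -> exists2 e : R, 0 < e & forall l, time_change l ->
     (forall t, `|val (l t) - val t| < e) -> S (l s)) ->
  continuous f -> measurable (hits S f c : set (borel (Omega R d))).
Proof. by move=> HS cf; apply: sub_sigma_algebra; exact: hits_open. Qed.

(** At time 1, which time changes fix, [hits_open] applies to the window [[set 1]].
    At [t < 1] the path is right-continuous, so its value is below [c] iff the path
    stays below some level less than [c] during some window [S n]. *)
Lemma measurable_pairing_at (R : realType) (d : nat) (t : I01 R)
    (f : torus R d -> R) :
  continuous f ->
  measurable_fun [set: borel (Omega R d)] (fun w => pairing f ((w : Omega R d) t)).
Proof.
move=> cf; have /andP[t0 t1] := I01_val01 t.
have [tE|tN1] := eqVneq (val t) 1.
  apply/measurable_EFinP; apply: lsc_measurable => c.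
  rewrite (_ : [set _ | _] = hits [set t] f c).
    apply: hits_open => // _ ->; exists 1 => // l tl _ /=.
    by apply/val_inj; rewrite (time_change1 tl).
  apply/seteqP; split=> w /=; first by rewrite lte_fin => ?; exists t.
  by move=> [_ ->]; rewrite lte_fin.
have {tN1}t1 : val t < 1 by rewrite lt_neqAle tN1.
pose S n : set (I01 R) := [set s | val t < val s < val t + n.+1%:R^-1].
have mS n c : measurable (hits (S n) f c : set (borel (Omega R d))).
  apply: measurable_hits => // s /andP[ts st].
  exists (Num.min (val s - val t) (val t + n.+1%:R^-1 - val s)).
    by rewrite lt_min !subr_gt0 ts.
  move=> l _ /(_ s); rewrite lt_min => /andP[]; rewrite !ltr_norml => /andP[h1 _] /andP[_ h2].
  by rewrite /S /=; move: h1 h2; rewrite opprB !ltrD2r => -> ->.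
have S0 n : S n !=set0.
  pose u := Num.min ((val t + 1) / 2) (val t + n.+1%:R^-1 / 2).
  have n0 : 0 < n.+1%:R^-1 :> R by rewrite invr_gt0.
  have tu : val t < u by rewrite lt_min (midf_lt t1).1 ltrDl divr_gt0.
  have u1 : u \in `[0, 1]%classic.
    rewrite inE /= in_itv /= (le_trans t0 (ltW tu)) /= ge_min.
    by rewrite (ltW (midf_lt t1).2).
  exists (SigSub u1); rewrite /S /= tu /= gt_min; apply/orP; right.
  by rewrite ltrD2l ltr_pdivrMr// ltr_pMr// ltr1n.
have right (w : Omega R d) (U : set R) : nbhs (pairing f (w t)) U ->
    exists n, forall s m, (n <= m)%N -> S m s -> U (pairing f (w s)).
  move=> nU; have [wt _] := path_cadlag w t.
  have := cvg_comp _ _ wt (@pairing_continuous R d f cf (w t)) U nU.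
  move=> /I01_nbhsP[e e0 He].
  have [n] := ltr_add_invr e0; rewrite add0r => ne.
  exists n => s m nm /andP[ts st]; apply: He => //.
  rewrite ger0_norm ?subr_ge0 ?ltW// ltrBlDl (lt_le_trans st)// lerD2l.
  by rewrite (le_trans _ (ltW ne))// lef_pV2 ?posrE ?ltr0n// ler_nat.
move=> mT; apply: (measurability _ (RGenInftyO.measurableE R)) => //.
move=> _ [_ [c ->] <-]; rewrite setTI.
rewrite (_ : _ @^-1` _ = \bigcup_k \bigcup_n ~` hits (S n) f (c - k.+1%:R^-1)).
  by apply: bigcupT_measurable => k; apply: bigcupT_measurable => n; apply: measurableC.
apply/seteqP; split=> w /=; rewrite in_itv /=.
  move=> wc; have [k kc] := ltr_add_invr wc.
  rewrite -ltrBrDr in kc.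
  have [n Hn] := right w _ (lt_nbhsl kc).
  exists k => //; exists n => // -[s Ss]; apply/negP; rewrite -leNgt ltW//.
  exact: (Hn s n).
move=> [k _ [n _ Hw]]; rewrite ltNge; apply/negP => cw.
have k0 : 0 < k.+1%:R^-1 :> R by rewrite invr_gt0.
have kc : c - k.+1%:R^-1 < pairing f ((w : Omega R d) t).
  by rewrite (lt_le_trans _ cw)// gtrBl.
have [m Hm] := right w _ (lt_nbhsr kc).
have [s Ss] := S0 (maxn m n); apply: Hw; exists s.
  move: Ss => /andP[ts st]; rewrite /S /= ts /= (lt_le_trans st)// lerD2l.
  by rewrite lef_pV2 ?posrE ?ltr0n// ler_nat ltnS leq_maxr.
exact: (Hm s (maxn m n) (leq_maxl _ _)).
Qed.
Lemma measurable_mass_at (R : realType) (d : nat) (t : I01 R)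
    (A : set (borel (torus R d))) :
  measurable A ->
  measurable_fun [set: borel (Omega R d)] (fun w => (w : Omega R d) t A).
Proof.
move=> mA; apply: (@measurable_fmeas_family R d _ (borel (Omega R d))
  (fun w => (w : Omega R d) t)) => //.
by move=> f cf; exact: measurable_pairing_at.
Qed.

Lemma measurable_sup_mass (R : realType) (d : nat) :
  measurable_fun [set: borel (Omega R d)] (fun w => sup_mass (w : Omega R d)).
Proof.
apply: lsc_measurable => c.
rewrite (_ : [set _ | _] = hits setT (cst 1) c).
  apply: hits_open; last exact: cst_continuous.
  by move=> s _; exists 1.
apply/seteqP; split=> w /=; rewrite /sup_mass.
  move=> /ereal_sup_gt[_ [s _ <-] cs]; exists s => //.
  by rewrite -lte_fin pairing_cst1.
move=> [s _ cs]; apply: (@lt_le_trans _ _ (w s setT)).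
  by rewrite -pairing_cst1 lte_fin.
by apply: ereal_sup_ubound; exists s.
Qed.

Lemma measurable_mass (R : realType) (d : nat) :
  measurable_fun [set: borel (fmeas R d)] (fun m : fmeas R d => m [set: borel (torus R d)]).
Proof.
under eq_fun do rewrite -pairing_cst1.
apply/measurable_EFinP.
apply: (@continuous_borel_measurable _ (fmeas R d) (pairing (cst 1))).
by apply: pairing_continuous; exact: cst_continuous.
Qed.

Lemma mass_le_sup (R : realType) (d : nat) (w : Omega R d) t :
  (w t [set: borel (torus R d)] <= sup_mass w)%E.
Proof. by apply: ereal_sup_ubound; exists t. Qed.

(** * The mean measure of a random measure *)
Section mean.
Context (R : realType) (d : nat) {disp} {W : measurableType disp}.
Variables (P : probability W R) (mu : W -> fmeas R d).
Hypothesis mmu : forall A : set (borel (torus R d)), measurable A ->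
  measurable_fun setT (fun w => mu w A).
Hypothesis fmu : (\int[P]_w mu w setT < +oo)%E.
Local Open Scope ereal_scope.

Definition mean_fun (A : set (borel (torus R d))) : \bar R := \int[P]_w mu w A.

Let mean0 : mean_fun set0 = 0.
Proof. by rewrite /mean_fun; under eq_integral do rewrite measure0; rewrite integral0. Qed.

Let mean_ge0 A : 0 <= mean_fun A.
Proof. exact: integral_ge0. Qed.

Let mean_sigma : semi_sigma_additive mean_fun.
Proof.
move=> F mF tF mUF.
rewrite [X in _ --> X](_ : _ = \sum_(n <oo) mean_fun (F n)).
  by apply: is_cvg_nneseries => n _ _; exact: mean_ge0.
rewrite /mean_fun -integral_nneseries//; last by move=> n; exact: mmu.
by apply: eq_integral => w _; rewrite measure_bigcup//; apply: eq_eseriesl => n; rewrite in_setT.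
Qed.

HB.instance Definition _ := isMeasure.Build _ _ _ mean_fun mean0 mean_ge0 mean_sigma.

Let mean_fin : fin_num_fun mean_fun.
Proof.
move=> A mA; rewrite ge0_fin_numE//; apply: le_lt_trans fmu.
apply: ge0_le_integral => //; [exact: mmu|exact: mmu|].
by move=> w _; apply: le_measure; rewrite ?inE.
Qed.

HB.instance Definition _ := @Measure_isFinite.Build _ _ _ mean_fun mean_fin.

Definition mean_fmeas : fmeas R d :=
  (mean_fun : {finite_measure set (borel (torus R d)) -> \bar R}).
Import HBNNSimple.

Lemma measurable_integral_family (f : borel (torus R d) -> \bar R) :
  measurable_fun setT f -> (forall x, 0 <= f x) ->
  measurable_fun setT (fun w => \int[mu w]_x f x).
Proof.
by move=> mf f0; apply: (measurable_fun_integral_kernel (l := fun w => mu w)).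
Qed.

(** Campbell's formula. It holds for simple functions by the definition of the mean,
    and both sides are continuous along increasing sequences. *)
Lemma integral_mean (f : borel (torus R d) -> \bar R) :
  measurable_fun setT f -> (forall x, 0 <= f x) ->
  \int[mean_fmeas]_x f x = \int[P]_w \int[mu w]_x f x.
Proof.
move=> mf f0.
pose g := nnsfun_approx measurableT mf.
have mg n : measurable_fun setT (EFin \o g n).
  by apply/measurable_EFinP; exact: measurable_funPT.
have g0 n x : 0 <= (EFin \o g n) x by rewrite lee_fin.
have ndg x : {homo (fun n => (EFin \o g n) x) : n m / (n <= m)%N >-> n <= m}.
  by move=> n m nm; rewrite lee_fin; exact/lefP/nd_nnsfun_approx.
have cg x : (EFin \o g n) x @[n --> \oo] --> f x.
  by apply: cvg_nnsfun_approx.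
have gE n : \int[mean_fmeas]_x (EFin \o g n) x = \int[P]_w \int[mu w]_x (EFin \o g n) x.
  have sE (m : {measure set (borel (torus R d)) -> \bar R}) :
      \int[m]_x (EFin \o g n) x =
      \sum_(r \in range (g n)) r%:E * m (g n @^-1` [set r]).
    by rewrite integral_nnsfun// sintegralE patch_setT.
  have mgr r : measurable (g n @^-1` [set r]) by exact: measurable_sfunP.
  rewrite sE; under [RHS]eq_integral => w _ do rewrite sE.
  rewrite ge0_integral_fsum//.
  - apply: eq_fsbigr => r /[1!inE] -[x _ <-].
    rewrite ge0_integralZl//; last by rewrite lee_fin.
    by apply: mmu; exact: mgr.
  - by move=> r; apply: emeasurable_funM => //; apply: mmu; exact: mgr.
  - move=> r w _; have [r0|r0] := leP 0%R r; first by rewrite mule_ge0// lee_fin.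
    rewrite preimage_nnfun0// measure0 mule0//.
have L := @monotone_convergence_cvg _ _ _ mean_fmeas _ _ mg g0 ndg cg.
have Rr : \int[P]_w \int[mu w]_x (EFin \o g n) x @[n --> \oo] --> \int[P]_w \int[mu w]_x f x.
  apply: monotone_convergence_cvg.
  - by move=> n; exact: measurable_integral_family.
  - by move=> n w; apply: integral_ge0 => x _; exact: g0.
  - move=> w n m nm; apply: ge0_le_integral => //.
    by move=> x _; exact: ndg.
  - by move=> w; exact: (monotone_convergence_cvg mg g0 ndg cg).
have : \int[mean_fmeas]_x (EFin \o g n) x @[n --> \oo] --> \int[P]_w \int[mu w]_x f x.
  by under eq_fun do rewrite gE.
exact: cvg_unique L.
Qed.


Lemma le_pairing (m : fmeas R d) (f : torus R d -> R) (M : R) : continuous f ->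
  (forall x, `|f x| <= M)%R -> `|(pairing f m)%:E| <= M%:E * m setT.
Proof.
move=> cf fM; rewrite pairingE//.
have mf : measurable_fun [set: borel (torus R d)] (fun x => (f x)%:E).
  by apply/measurable_EFinP; exact: continuous_borel_measurable.
apply: (le_trans (le_abse_integral _ _ _)) => //.
rewrite -integral_cst//; apply: ge0_le_integral => //.
- exact: measurableT_comp.
- by move=> x _; rewrite lee_fin; exact: fM.
Qed.

(** Shifting by a bound of [f] reduces a continuous test function to a nonnegative
    one. *)
Lemma integral_shift (m : fmeas R d) (f : torus R d -> R) (M : R) : continuous f ->
  \int[m]_(x in [set: borel (torus R d)]) (f x + M)%:E =
  (pairing f m)%:E + M%:E * m setT.
Proof.
move=> cf; rewrite pairingE// -integral_cst//.
apply: integralD_EFin => //; first exact: integrable_continuous.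
by apply: (@integrable_continuous R d m (cst M)); exact: cst_continuous.
Qed.

Lemma measurable_pairing_family (f : torus R d -> R) : continuous f ->
  measurable_fun setT (fun w => (pairing f (mu w))%:E).
Proof.
move=> cf; have [M M0 fM] := torus_bounded cf.
have fM0 x : 0 <= (f x + M)%:E.
  by rewrite lee_fin -lerBlDr sub0r; have := fM x; rewrite ler_norml => /andP[].
rewrite (_ : (fun w => _) = (fun w => \int[mu w]_x (f x + M)%:E - M%:E * mu w setT)).
  apply: emeasurable_funB.
    apply: measurable_integral_family => //.
    apply/measurable_EFinP; apply: measurable_funD => //.
    exact: continuous_borel_measurable.
  by apply: emeasurable_funM => //; exact: mmu.
apply/funext => w; rewrite integral_shift// addeK// fin_numM//.
exact: fin_num_measure.
Qed.

Lemma integrable_pairing_family (f : torus R d -> R) : continuous f ->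
  P.-integrable setT (fun w => (pairing f (mu w))%:E).
Proof.
move=> cf; have [M M0 fM] := torus_bounded cf.
apply: (@le_integrable _ _ _ P setT measurableT _ (fun w => M%:E * mu w setT)).
- exact: measurable_pairing_family.
- move=> w _; rewrite [leRHS]gee0_abs; first exact: le_pairing.
  by rewrite mule_ge0// lee_fin ltW.
- apply: integrableZl => //; apply/integrableP; split; first exact: mmu.
  by under eq_integral do rewrite gee0_abs//.
Qed.

Lemma pairing_mean (f : torus R d -> R) : continuous f ->
  (pairing f mean_fmeas)%:E = \int[P]_w (pairing f (mu w))%:E.
Proof.
move=> cf; have [M M0 fM] := torus_bounded cf.
have fM0 x : 0 <= (f x + M)%:E.
  by rewrite lee_fin -lerBlDr sub0r; have := fM x; rewrite ler_norml => /andP[].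
have mfM : measurable_fun [set: borel (torus R d)] (fun x => (f x + M)%:E).
  apply/measurable_EFinP; apply: measurable_funD => //.
  exact: continuous_borel_measurable.
have := integral_mean mfM fM0; rewrite integral_shift//.
under eq_integral do rewrite integral_shift//.
have imass : P.-integrable setT (fun w => mu w setT).
  apply/integrableP; split; first exact: mmu.
  by under eq_integral do rewrite gee0_abs//.
rewrite integralD//; last 2 first.
- exact: integrable_pairing_family.
- exact: integrableZl.
rewrite integralZl// -[mean_fmeas setT]/(\int[P]_w mu w setT).
have Mfin : M%:E * \int[P]_w mu w setT \is a fin_num.
  by rewrite fin_numM// integrable_fin_num.
by move=> /(congr1 (fun z => z - M%:E * \int[P]_w mu w setT)); rewrite !addeK.
Qed.

End mean.

(** One-sided limits are tested along sequences, because dominated convergence is a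
    statement about sequences. *)
Definition near_seq (R : realType) (D : set (I01 R)) (t : I01 R)
    (s : nat -> I01 R) :=
  forall n, D (s n) /\ `|val (s n) - val t| < n.+1%:R^-1.

Lemma near_seq_cvg (R : realType) (D : set (I01 R)) (t : I01 R)
    (s : nat -> I01 R) :
  near_seq D t s -> s @ \oo --> within D (nbhs t).
Proof.
move=> st A /I01_nbhsP[e e0 He].
have [n] := ltr_add_invr e0; rewrite add0r => ne.
exists n => // m /= nm; have [Ds sm] := st m; apply: (He (s m)) => //.
apply: (lt_trans sm); apply: (le_lt_trans _ ne).
by rewrite lef_pV2 ?posrE ?ltr0n// ler_nat.
Qed.

Lemma within_seq_cvg (R : realType) (D : set (I01 R)) (t : I01 R)
    (g : I01 R -> R) (l : R) :
  (forall s, near_seq D t s -> g (s n) @[n --> \oo] --> l) ->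
  g @ within D (nbhs t) --> l.
Proof.
move=> H; apply/cvgrPdist_lt => e e0; apply: contrapT => nH.
have /choice[s Hs] : forall n : nat, exists s : I01 R, [/\ D s,
    `|val s - val t| < n.+1%:R^-1 & e <= `|l - g s|].
  move=> n; apply: contrapT => nex; apply: nH; apply/I01_nbhsP.
  exists n.+1%:R^-1; first by rewrite invr_gt0.
  move=> s st Ds; rewrite ltNge; apply/negP => es; apply: nex.
  by exists s; split.
have /H /cvgrPdist_lt /(_ _ e0) [n _ Hn] : near_seq D t s.
  by move=> n; have [] := Hs n.
by have [_ _] := Hs n; rewrite leNgt Hn //=.
Qed.

Lemma left_near_seq (R : realType) (t : I01 R) : 0 < val t ->
  exists s, near_seq [set s | val s < val t] t s.
Proof.
move=> t0; have /andP[_ t1] := I01_val01 t.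
pose u n := val t * (1 - n.+2%:R^-1).
have n0 n : 0 < n.+2%:R^-1 :> R by rewrite invr_gt0.
have n1 n : n.+2%:R^-1 < 1 :> R by rewrite invf_lt1// ltr1n.
have ut n : u n < val t by rewrite /u gtr_pMr// gtrBl.
have u01 n : u n \in `[0, 1]%classic.
  by rewrite inE /= in_itv /= (le_trans (ltW (ut n)) t1) andbT mulr_ge0 ?subr_ge0 ?ltW.
exists (fun n => SigSub (u01 n)) => n; split; first exact: ut.
rewrite /= distrC gtr0_norm ?subr_gt0// /u mulrBr mulr1 opprB addrC subrK.
apply: (@le_lt_trans _ _ n.+2%:R^-1); first by rewrite ler_piMl// ltW.
by rewrite ltf_pV2 ?posrE ?ltr0n// ltr_nat.
Qed.

Lemma sup_mass_ge0 (R : realType) (d : nat) (w : Omega R d) : (0 <= sup_mass w)%E.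
Proof. by apply: le_trans (mass_le_sup w (I01_0 R)). Qed.

Section mean_path.
Context (R : realType) (d : nat) (P : probability (borel (Omega R d)) R).
Hypothesis supfin : (\int[P]_w sup_mass (w : Omega R d) < +oo)%E.
Local Open Scope ereal_scope.

Let fam_fin (mu : borel (Omega R d) -> fmeas R d) :
  (forall A : set (borel (torus R d)), measurable A ->
    measurable_fun setT (fun w => mu w A)) ->
  (forall w, mu w [set: borel (torus R d)] <= sup_mass w) ->
  \int[P]_w mu w [set: borel (torus R d)] < +oo.
Proof.
move=> mmu mule; apply: le_lt_trans supfin; apply: ge0_le_integral => //.
- exact: mmu.
- exact: measurable_sup_mass.
Qed.

Lemma mean_at_fin t : \int[P]_w (w : Omega R d) t [set: borel (torus R d)] < +oo.
Proof.
apply: (fam_fin (mu := fun w => (w : Omega R d) t)).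
  by move=> A; exact: measurable_mass_at.
by move=> w; exact: mass_le_sup.
Qed.

Definition mean_path (t : I01 R) : fmeas R d :=
  mean_fmeas (@measurable_mass_at R d t) (mean_at_fin t).

(** Dominated convergence: if [M] bounds [f], then [M * sup_mass] bounds the pairing
    of [f] with the path at all times. *)
Lemma mean_path_cvg (D : set (I01 R)) (t : I01 R)
    (L : borel (Omega R d) -> fmeas R d)
    (mL : forall A : set (borel (torus R d)), measurable A ->
      measurable_fun setT (fun w => L w A))
    (fL : \int[P]_w L w [set: borel (torus R d)] < +oo) :
  (forall w : Omega R d, w @ within D (nbhs t) --> L w) ->
  mean_path @ within D (nbhs t) --> mean_fmeas mL fL.
Proof.
move=> wL; apply: fmeas_cvgP => f cf; apply: within_seq_cvg => s st.
have [M M0 fM] := torus_bounded cf.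
have [] := @dominated_convergence _ _ _ P setT measurableT
  (fun n w => (pairing f ((w : Omega R d) (s n)))%:E) (fun w => (pairing f (L w))%:E)
  (fun w => M%:E * sup_mass (w : Omega R d)).
- move=> n; apply/measurable_EFinP; exact: measurable_pairing_at.
- exact: measurable_pairing_family.
- apply/aeW => w _; apply/cvg_EFin; first exact: nearW.
  have := cvg_comp _ _ (near_seq_cvg st) (wL (w : Omega R d)).
  by move=> /cvg_comp; apply; exact: pairing_continuous.
- apply: integrableZl => //; apply/integrableP; split.
    exact: measurable_sup_mass.
  under eq_integral => w _ do rewrite gee0_abs ?sup_mass_ge0//.
  exact: supfin.
- apply/aeW => w n _; apply: (le_trans (le_pairing _ cf fM)).
  by rewrite lee_wpmul2l ?lee_fin ?(ltW M0)// mass_le_sup.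
move=> _ _; rewrite -pairing_mean// => /fine_cvg; apply: cvg_trans.
apply: near_eq_cvg; apply: nearW => n /=.
exact: (congr1 fine (esym
  (pairing_mean (@measurable_mass_at R d (s n)) (mean_at_fin (s n)) cf))).
Qed.

Lemma mean_path_cadlag : cadlag mean_path.
Proof.
move=> t; split.
  apply: mean_path_cvg => w.
  exact: (path_cadlag w t).1.
have [t0|t0] := ltP 0%R (val t); last first.
  (* at time 0 the left filter is trivial *)
  exists (mean_path t) => A _; rewrite /at_left01.
  apply/I01_nbhsP; exists 1%R => // s _ /= st.
  by have /andP[s0 _] := I01_val01 s; move: st; rewrite ltNge (le_trans t0).
have [s st] := left_near_seq t0.
have /choice[L wL] : forall w : Omega R d, exists m : fmeas R d,
    w @ at_left01 t --> m by move=> w; have [_] := path_cadlag w t.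
have pL (f : torus R d -> R) : continuous f -> forall w : Omega R d,
    pairing f (w (s n)) @[n --> \oo] --> pairing f (L w).
  move=> cf w; have := cvg_comp _ _ (near_seq_cvg st) (wL w).
  by move=> /cvg_comp; apply; exact: pairing_continuous.
(* The left limits were chosen path by path; they are nevertheless measurable in
   the path, as limits along the single sequence [s]. *)
have mL (A : set (borel (torus R d))) : measurable A ->
    measurable_fun setT (fun w : borel (Omega R d) => L w A).
  move: A; apply: measurable_fmeas_family => f cf.
  apply/measurable_EFinP.
  apply: (emeasurable_fun_cvg (fun n (w : borel (Omega R d)) =>
    (pairing f ((w : Omega R d) (s n)))%:E)).
    by move=> n; apply/measurable_EFinP; exact: measurable_pairing_at.
  by move=> w _; apply/cvg_EFin; [exact: nearW|exact: pL].
have Lle (w : Omega R d) : L w [set: borel (torus R d)] <= sup_mass w.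
  have cL : (w (s n) [set: borel (torus R d)]) @[n --> \oo] --> L w [set: borel (torus R d)].
    rewrite -pairing_cst1; under eq_fun do rewrite -pairing_cst1.
    apply/cvg_EFin; first exact: nearW.
    by apply: pL; exact: cst_continuous.
  apply: (cvge_le _ cL); apply: nearW => n; exact: mass_le_sup.
have fL : \int[P]_w L w [set: borel (torus R d)] < +oo.
  exact: fam_fin.
exists (mean_fmeas mL fL).
exact: mean_path_cvg.
Qed.

End mean_path.

(** * Independence of finitely many sources of randomness *)

HB.instance Definition _ (d : nat) := gen_eqMixin (source d).

Section cylinders.
Context {disp} {W : measurableType disp} {R : realType} {d : nat}.
Variables (Pr : probability W R) (G : source d -> set_system W).
Hypothesis indG : independent Pr G.
Hypothesis mG : forall s A, G s A -> measurable A.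

(** With lists of pairs, to reveal one more source is to add a head. *)
Definition cylinder (es : seq (source d * set W)) : set W :=
  foldr (fun e A => e.2 `&` A) setT es.

Definition independent_events (es : seq (source d * set W)) :=
  uniq (unzip1 es) /\ forall e, e \in es -> G e.1 e.2.

Lemma independent_events_cons s A es :
  independent_events ((s, A) :: es) <->
  [/\ s \notin unzip1 es, G s A & independent_events es].
Proof.
split=> [[/= /andP[sN ues] Ges]|[sN GA [ues Ges]]].
  split=> //; first by have := Ges (s, A); rewrite mem_head; exact.
  by split=> // e ein; apply: Ges; rewrite in_cons ein orbT.
split=> /=; first by rewrite sN.
by move=> e; rewrite in_cons => /orP[/eqP ->//|]; exact: Ges.
Qed.

Lemma measurable_cylinder es : independent_events es -> measurable (cylinder es).
Proof.
elim: es => [|[s A] es IH] /=; first by move=> _; exact: measurableT.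
move=> /independent_events_cons[_ GA /IH]; apply: measurableI.
exact: mG GA.
Qed.

Lemma cylinder_nth (es : seq (source d * set W)) w e0 :
  cylinder es w <-> forall k : 'I_(size es), (nth e0 es k).2 w.
Proof.
elim: es => [|e es IH] /=; first by split=> // _ [].
split=> [[ew /IH H] [[|k] //= kn]|H].
  exact: (H (Ordinal (kn : (k < size es)%N))).
split; first exact: (H ord0).
apply/IH => k; exact: (H (lift ord0 k)).
Qed.

Lemma cylinder_prob es : independent_events es ->
  fine (Pr (cylinder es)) = \prod_(e <- es) fine (Pr e.2).
Proof.
case: es => [_|e0 es].
  by rewrite big_nil /=; have -> : Pr setT = 1%E by exact: probability_setT.
move: (e0 :: es) => {}es [ues Ges].
pose J (k : 'I_(size es)) := (nth e0 es k).1.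
pose E (k : 'I_(size es)) := (nth e0 es k).2.
have injJ : injective J.
  move=> i j; rewrite /J -!(nth_map _ e0.1 fst) ?ltn_ord// => /eqP.
  by rewrite nth_uniq ?size_map// => /eqP ij; exact: ord_inj.
have GJ k : G (J k) (E k) by apply: Ges; rewrite mem_nth.
have := indG injJ GJ; rewrite (big_nth e0) big_mkord => <-.
congr (fine (Pr _)); apply/seteqP; split=> w.
  by move=> /(cylinder_nth es w e0) H k _; exact: H.
by move=> H; apply/(cylinder_nth es w e0) => k; exact: H.
Qed.

Lemma cylinder_prob_cons s A es : independent_events ((s, A) :: es) ->
  Pr (A `&` cylinder es) = (Pr A * Pr (cylinder es))%E.
Proof.
move=> ies; have ies' := ies; move: ies' => /independent_events_cons[_ GA ies'].
have mA := mG GA; have mes := measurable_cylinder ies'.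
rewrite -(fineK (fin_num_measure Pr _ mA)) -(fineK (fin_num_measure Pr _ mes)).
rewrite -(fineK (fin_num_measure Pr _ (measurable_cylinder ies))) -EFinM.
congr EFin; rewrite (cylinder_prob ies) big_cons /=.
by rewrite (cylinder_prob ies').
Qed.

End cylinders.

(** * Exponential functionals of the genealogical tree *)

Definition child (u : label) (k : nat) : label := (u.1, k :: u.2).

(** Child indices are stored with the most recent one first, so a line of descent is
    a chain of suffixes. A particle counts among its own ancestors. *)
Definition ancestor (u x : label) : bool := (u.1 == x.1) && suffix u.2 x.2.

Lemma ancestor_refl u : ancestor u u.
Proof. by rewrite /ancestor eqxx suffix_refl. Qed.

Lemma ancestor_child u x k :
  ancestor u (child x k) = (u == child x k) || ancestor u x.
Proof.
case: u x => i v [j y]; rewrite /ancestor /child /= xpair_eqE -andb_orr.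
congr (_ && _); apply/idP/orP => [/suffixP[[|k' p] /= pE]|[/eqP ->|/suffixP[p ->]]].
- by left; apply/eqP.
- by right; apply/suffixP; exists p; case: pE.
- exact: suffix_refl.
- by apply/suffixP; exists (k :: p).
Qed.

Lemma ancestor_trans u x y : ancestor u x -> ancestor x y -> ancestor u y.
Proof.
move=> /andP[/eqP ux sux] /andP[/eqP xy sxy]; rewrite /ancestor ux xy eqxx /=.
exact: suffix_trans sxy.
Qed.

Lemma child_ancestor u x k : ancestor (child u k) x -> ancestor u x.
Proof. by apply: ancestor_trans; rewrite ancestor_child ancestor_refl orbT. Qed.

Lemma ancestor_size u x : ancestor u x -> (size u.2 <= size x.2)%N.
Proof. by move=> /andP[_]; exact: size_suffix. Qed.

Lemma child_nancestor u k : ancestor (child u k) u = false.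
Proof. by apply/negP => /ancestor_size; rewrite /= ltnn. Qed.

Definition ancestor_of_source {d : nat} (u : label) (s : source d) : bool :=
  match s with
  | Clock x | Offspring x => ancestor u x
  | _ => false
  end.

(** When the subtrees rooted at [ls] are disjoint and contain none of the sources
    [ss], they are independent of one another and of the events already revealed
    about [ss]. *)
Definition fresh_roots {d : nat} (ss : seq (source d)) (ls : seq label) :=
  [/\ uniq ls, {in ls &, forall a b, ancestor a b -> a = b} &
   {in ss & ls, forall s l, ~~ ancestor_of_source l s}].

Lemma fresh_roots_behead {d : nat} (ss : seq (source d)) u ls :
  fresh_roots ss (u :: ls) -> fresh_roots ss ls.
Proof.
move=> [/= /andP[_ uls] Hanc Hs]; split=> //.
  by move=> a b al bl; apply: Hanc; rewrite in_cons (al, bl) orbT.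
by move=> s l sin lin; apply: Hs => //; rewrite in_cons lin orbT.
Qed.

(** Revealing the lifetime and the offspring number of the root [u] replaces it by
    its children. *)
Lemma fresh_roots_expand {d : nat} (ss : seq (source d)) u k ls :
  fresh_roots ss (u :: ls) ->
  fresh_roots (Clock d u :: Offspring d u :: ss)
    (ls ++ [seq child u j | j <- iota 0 k]).
Proof.
move=> [/= /andP[uN uls] Hanc Hs].
have uin : u \in u :: ls by rewrite mem_head.
have lin l : l \in ls -> l \in u :: ls by rewrite in_cons => ->; rewrite orbT.
have Nanc1 l : l \in ls -> ancestor u l = false.
  move=> ll; apply/negP => /(Hanc _ _ uin (lin _ ll)) ul.
  by move: uN; rewrite ul ll.
have Nanc2 l : l \in ls -> ancestor l u = false.
  move=> ll; apply/negP => /(Hanc _ _ (lin _ ll) uin) ul.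
  by move: uN; rewrite -ul ll.
have Nl j : child u j \notin ls.
  apply/negP => /Nanc1; rewrite ancestor_child ancestor_refl orbT //.
split.
- rewrite cat_uniq uls map_inj_uniq ?iota_uniq ?andbT /=; last by move=> a b [].
  by apply/hasPn => _ /mapP[j _ ->].
- move=> a b; rewrite !mem_cat => /orP[al|/mapP[j _ ->]] /orP[bl|/mapP[j' _ ->]].
  + by apply: Hanc; exact: lin.
  + by rewrite ancestor_child Nanc2// orbF => /eqP.
  + by move=> /child_ancestor; rewrite Nanc1.
  + by rewrite ancestor_child child_nancestor orbF => /eqP.
- move=> s l; rewrite !in_cons mem_cat.
  move=> /or3P[/eqP ->|/eqP ->|sin] /orP[ll|/mapP[j _ ->]] /=.
  + by rewrite Nanc2.
  + by rewrite child_nancestor.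
  + by rewrite Nanc2.
  + by rewrite child_nancestor.
  + by apply: Hs => //; exact: lin.
  + have := Hs _ _ sin uin; apply: contraNN.
    by case: s {sin} => //= x; exact: child_ancestor.
Qed.

Lemma fresh_roots_notin {d : nat} (ss : seq (source d)) u ls :
  fresh_roots ss (u :: ls) ->
  Clock d u \notin Offspring d u :: ss /\ Offspring d u \notin ss.
Proof.
move=> [_ _ Hs]; have uin : u \in u :: ls by rewrite mem_head.
split; last by apply/negP => /Hs /(_ uin) /=; rewrite ancestor_refl.
by rewrite in_cons negb_or; apply/andP; split; [apply/eqP|
  apply/negP => /Hs /(_ uin) /=; rewrite ancestor_refl].
Qed.
Lemma measurable_random_index disp (W : measurableType disp) (R : realType)
    (N : W -> nat) (F : nat -> W -> R) :
  (forall k, measurable (N @^-1` [set k])) ->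
  (forall k, measurable_fun setT (F k)) -> measurable_fun setT (fun w => F (N w) w).
Proof.
move=> mN mF _ A mA; rewrite setTI.
rewrite (_ : _ @^-1` A = \bigcup_k (N @^-1` [set k] `&` F k @^-1` A)).
  apply: bigcupT_measurable => k; apply: measurableI => //.
  by rewrite -[X in measurable X]setTI; exact: mF.
by apply/seteqP; split=> w /=; [move=> Aw; exists (N w)|move=> [k _ [<-]]].
Qed.

Section progeny_moment.
Context {disp} {W : measurableType disp} {R : realType} {d : nat}.
Variables (Pr : probability W R) (G : source d -> set_system W).
Hypothesis indG : independent Pr G.
Hypothesis mG : forall s A, G s A -> measurable A.
Variables (short : label -> set W) (off : label -> W -> nat).
Hypothesis Gshort : forall u, G (Clock d u) (short u).
Hypothesis Glong : forall u, G (Clock d u) (~` short u).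
Hypothesis Goff : forall u k, G (Offspring d u) (off u @^-1` [set k]).
Variables (eps a : R).
Hypothesis eps0 : 0 <= eps.
Hypothesis a1 : 1 <= a.

Definition weight u w : R := if w \in short u then 1 else eps.

(** For [a = expR c] this dominates [expR (c * T)], where [T] is the total weight of
    the tree of [u] cut at generation [n]. Unlike the latter it is built from
    indicators of events attached to single sources, to which the product formula
    for independent events applies directly. *)
Fixpoint progeny_exp n u w : R :=
  if n is n'.+1 then
    a * (1 + weight u w * \prod_(k < off u w) progeny_exp n' (child u k) w)
  else 1.

Lemma weight_ge0 u w : 0 <= weight u w.
Proof. by rewrite /weight; case: ifP. Qed.

Lemma progeny_exp_ge1 n u w : 1 <= progeny_exp n u w.
Proof.
elim: n u => [|n IH] u //=; rewrite -[leLHS]mulr1 ler_pM// lerDl mulr_ge0//.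
  exact: weight_ge0.
by apply: prodr_ge0 => k _; exact: le_trans (IH _).
Qed.

Lemma progeny_exp_ge0 n u w : 0 <= progeny_exp n u w.
Proof. exact: le_trans (progeny_exp_ge1 n u w). Qed.

Lemma progeny_exp_le n u w : progeny_exp n u w <= progeny_exp n.+1 u w.
Proof.
elim: n u => [|n IH] u; first exact: progeny_exp_ge1.
rewrite /= ler_wpM2l ?(le_trans ler01)// lerD2l ler_wpM2l ?weight_ge0//.
by apply: ler_prod => k _; rewrite progeny_exp_ge0 IH.
Qed.

Lemma measurable_prod_seq (I : Type) (s : seq I) (F : I -> W -> R) :
  (forall i, measurable_fun setT (F i)) ->
  measurable_fun setT (fun w => \prod_(i <- s) F i w).
Proof.
move=> mF; elim: s => [|i s IH].
  by under eq_fun do rewrite big_nil; exact: measurable_cst.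
by under eq_fun do rewrite big_cons; exact: measurable_funM.
Qed.

Lemma measurable_weight u : measurable_fun setT (weight u).
Proof.
rewrite (_ : weight u = fun w => eps + (1 - eps) * \1_(short u) w).
  apply: measurable_funD => //; apply: measurable_funM => //.
  by apply: measurable_indic; exact: mG (Gshort u).
apply/funext => w; rewrite /weight indicE; case: ifP => _; first by rewrite mulr1 subrKC.
by rewrite mulr0 addr0.
Qed.

Lemma measurable_progeny_exp n u : measurable_fun setT (progeny_exp n u).
Proof.
elim: n u => [|n IH] u /=; first exact: measurable_cst.
apply: measurable_funM => //; apply: measurable_funD => //.
apply: measurable_funM; first exact: measurable_weight.
apply: (measurable_random_index (N := off u)
  (F := fun N w => \prod_(k < N) progeny_exp n (child u k) w)).
  by move=> k; exact: mG (Goff u k).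
move=> N; rewrite (_ : (fun w => _) =
    fun w => \prod_(k <- index_enum 'I_N) progeny_exp n (child u k) w)//.
by apply: measurable_prod_seq => k; exact: IH.
Qed.

(** Only two discrete quantities attached to [u] enter: on the event that the
    lifetime class is given and the offspring number is [k], the weight is constant
    and the product runs over exactly [k] children. *)
Lemma integral_weight_split u (E : set W) (F : W -> R) (H : nat -> W -> R) :
  measurable E -> measurable_fun setT F -> (forall w, 0 <= F w) ->
  (forall k, measurable_fun setT (H k)) -> (forall k w, 0 <= H k w) ->
  (\int[Pr]_(w in E) (weight u w * H (off u w) w * F w)%:E =
   \sum_(k <oo)
     (\int[Pr]_(w in short u `&` (off u @^-1` [set k] `&` E)) (H k w * F w)%:E +
      eps%:E *
      \int[Pr]_(w in ~` short u `&` (off u @^-1` [set k] `&` E)) (H k w * F w)%:E))%E.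
Proof.
move=> mE mF F0 mH H0.
have moff k : measurable (off u @^-1` [set k]) by exact: mG (Goff u k).
have mshort : measurable (short u) by exact: mG (Gshort u).
have mlong : measurable (~` short u) by exact: measurableC.
have mHF k : measurable_fun setT (fun w => (H k w * F w)%:E).
  by apply/measurable_EFinP; exact: measurable_funM.
have HF0 k w : (0 <= (H k w * F w)%:E)%E by rewrite lee_fin mulr_ge0.
have mI : measurable_fun setT (fun w => (weight u w * H (off u w) w * F w)%:E).
  apply/measurable_EFinP; apply: measurable_funM => //; apply: measurable_funM.
    exact: measurable_weight.
  exact: measurable_random_index.
have I0 w : (0 <= (weight u w * H (off u w) w * F w)%:E)%E.
  by rewrite lee_fin !mulr_ge0 ?weight_ge0.
have EE : E = \bigcup_k (off u @^-1` [set k] `&` E).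
  by apply/seteqP; split=> [w Ew|w [k _ []]] //; exists (off u w).
rewrite [in LHS]EE ge0_integral_bigcup//; last 3 first.
- by move=> k; exact: measurableI.
- by rewrite -EE; exact: measurable_funS mI.
- apply/trivIsetP => i j _ _ /eqP ij; apply/seteqP; split=> // w.
  by move=> [[/= wi _] [wj _]]; apply: ij; rewrite -wi -wj.
apply: eq_eseriesr => k _.
set B := off u @^-1` [set k] `&` E.
have mB : measurable B by exact: measurableI.
have BE : B = (short u `&` B) `|` (~` short u `&` B) by rewrite -setIUl setUv setTI.
rewrite [in LHS]BE ge0_integral_setU//; last 4 first.
- exact: measurableI.
- exact: measurableI.
- exact: measurable_funS mI.
- by apply/disj_setPS => w [[s _] [ns _]].
congr (_ + _)%E.
  apply: eq_integral => w; rewrite inE => -[sw [/= ok _]].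
  by rewrite ok /weight mem_set// mul1r.
rewrite -ge0_integralZl//; last 2 first.
- exact: measurableI.
- exact: measurable_funS (mHF k).
apply: eq_integral => w; rewrite inE => -[sw [/= ok _]].
by rewrite ok /weight memNset// -EFinM mulrA.
Qed.
Variables (m delta phi : R) (p : nat -> R).
Hypothesis m1 : 1 <= m.
Hypothesis p0 : forall k, 0 <= p k.
Hypothesis delta0 : 0 <= delta.
Hypothesis Pshort : forall u, (Pr (short u) <= delta%:E)%E.
Hypothesis Poff : forall u k, Pr (off u @^-1` [set k]) = (p k)%:E.
Hypothesis phiE : (\sum_(0 <= k <oo) (p k * m ^+ k)%:E <= phi%:E)%E.
Hypothesis fixpoint : a * (1 + (delta + eps) * phi) <= m.

Let a0 : 0 <= a. Proof. exact: le_trans a1. Qed.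
Let m0 : 0 <= m. Proof. exact: le_trans m1. Qed.

(** The roots in [ls1] are expanded one at a time, each being replaced by its
    children, for which one generation less remains; hence the two lists of roots.
    The revealed lifetime class and offspring number join the cylinder. *)
Lemma integral_prod_progeny_exp_step n :
  (forall es ls, independent_events G es -> fresh_roots (unzip1 es) ls ->
    (\int[Pr]_(w in cylinder es) (\prod_(l <- ls) progeny_exp n l w)%:E <=
     Pr (cylinder es) * (m ^+ size ls)%:E)%E) ->
  forall ls1 es ls0, independent_events G es -> fresh_roots (unzip1 es) (ls1 ++ ls0) ->
    (\int[Pr]_(w in cylinder es) (\prod_(l <- ls1) progeny_exp n.+1 l w *
                          \prod_(l <- ls0) progeny_exp n l w)%:E <=
     Pr (cylinder es) * (m ^+ (size ls1 + size ls0))%:E)%E.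
Proof.
move=> IHn; elim=> [|u ls1 IH] es ls0 ies fr.
  by under eq_integral do rewrite big_nil mul1r; exact: IHn.
set s := (size ls1 + size ls0)%N.
have mE := measurable_cylinder mG ies.
pose F w := \prod_(l <- ls1) progeny_exp n.+1 l w * \prod_(l <- ls0) progeny_exp n l w.
have F0 w : 0 <= F w by rewrite mulr_ge0// prodr_ge0// => l _; exact: progeny_exp_ge0.
have mF : measurable_fun setT F.
  by apply: measurable_funM; apply: measurable_prod_seq => l; exact: measurable_progeny_exp.
pose H k w := \prod_(j <- iota 0 k) progeny_exp n (child u j) w.
have H0 k w : 0 <= H k w by rewrite prodr_ge0// => l _; exact: progeny_exp_ge0.
have mH k : measurable_fun setT (H k).
  by apply: measurable_prod_seq => l; exact: measurable_progeny_exp.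
have HE w : \prod_(k < off u w) progeny_exp n (child u k) w = H (off u w) w.
  by rewrite /H -[in RHS](subn0 (off u w)) -/(index_iota _ _) big_mkord.
have mwHF : measurable_fun setT (fun w => (weight u w * H (off u w) w * F w)%:E).
  apply/measurable_EFinP; apply: measurable_funM => //; apply: measurable_funM.
    exact: measurable_weight.
  by apply: measurable_random_index => // k; exact: mG (Goff u k).
have wHF0 w : (0 <= (weight u w * H (off u w) w * F w)%:E)%E.
  by rewrite lee_fin mulr_ge0// mulr_ge0// weight_ge0.
set PE := Pr (cylinder es).
have PEfin : PE \is a fin_num by exact: fin_num_measure.
have PE0 : (0 <= PE)%E by exact: measure_ge0.
have [pe PEE] : exists pe : R, PE = pe%:E by exists (fine PE); rewrite fineK.
have pe0 : 0 <= pe by rewrite -lee_fin -PEE.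
rewrite [leLHS](_ : _ = a%:E * (\int[Pr]_(w in cylinder es) (F w)%:E +
    \int[Pr]_(w in cylinder es) (weight u w * H (off u w) w * F w)%:E))%E; last first.
  have FE0 w : cylinder es w -> (0 <= (F w)%:E)%E by rewrite lee_fin.
  have mFE : measurable_fun setT (fun w => (F w)%:E) by exact/measurable_EFinP.
  rewrite -ge0_integralD//; [|exact: measurable_funTS..].
  rewrite -ge0_integralZl//; last 2 first.
  - by apply: measurable_funTS; exact: emeasurable_funD.
  - by move=> w Ew; rewrite adde_ge0// FE0.
  apply: eq_integral => w _.
  rewrite big_cons /= HE -EFinD -EFinM -mulrA -/(F w).
  by rewrite -[X in _ = (a * (X + _))%:E]mul1r -mulrDl mulrA.
have HF : (\int[Pr]_(w in cylinder es) (F w)%:E <= PE * (m ^+ s)%:E)%E.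
  by apply: IH => //; exact: fresh_roots_behead fr.
have fr' := fresh_roots_expand _ fr.
have [uN1 uN2] := fresh_roots_notin fr.
(* One term of the expansion: the lifetime of [u] is in [A], and [u] has [k]
   children. *)
have Hterm A k : G (Clock d u) A ->
   (\int[Pr]_(w in A `&` (off u @^-1` [set k] `&` cylinder es)) (H k w * F w)%:E <=
   Pr A * ((p k)%:E * PE) * (m ^+ (s + k))%:E)%E.
  move=> GA.
  have ies2 : independent_events G ((Offspring d u, off u @^-1` [set k]) :: es).
    by apply/independent_events_cons; split.
  have ies1 : independent_events G
      ((Clock d u, A) :: (Offspring d u, off u @^-1` [set k]) :: es).
    by apply/independent_events_cons; split.
  have := IH _ (ls0 ++ [seq child u j | j <- iota 0 k]) ies1.
  rewrite catA => /(_ (fr' k)).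
  rewrite [Pr (cylinder _)](cylinder_prob_cons indG mG ies1).
  rewrite [Pr (cylinder _)](cylinder_prob_cons indG mG ies2) Poff.
  rewrite size_cat size_map size_iota addnA; apply: le_trans.
  rewrite le_eqVlt; apply/orP; left; apply/eqP; apply: eq_integral => w _.
  by rewrite big_cat big_map /F mulrC -mulrA.
have HG : (\int[Pr]_(w in cylinder es) (weight u w * H (off u w) w * F w)%:E <=
    ((delta + eps) * phi)%:E * (PE * (m ^+ s)%:E))%E.
  rewrite integral_weight_split//.
  have PEms0 : (0 <= PE * (m ^+ s)%:E)%E by rewrite mule_ge0// lee_fin exprn_ge0.
  apply: (@le_trans _ _ (\sum_(0 <= k <oo)
      (((delta + eps) * (pe * m ^+ s))%:E * (p k * m ^+ k)%:E))%E).
    apply: lee_nneseries => k _.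
      rewrite adde_ge0// ?mule_ge0 ?lee_fin// integral_ge0// => w _;
        by rewrite lee_fin mulr_ge0.
    have X0 : (0 <= (p k)%:E * PE * (m ^+ (s + k))%:E)%E.
      by rewrite !mule_ge0// lee_fin// exprn_ge0.
    apply: (@le_trans _ _ (delta%:E * ((p k)%:E * PE * (m ^+ (s + k))%:E) +
        eps%:E * ((p k)%:E * PE * (m ^+ (s + k))%:E))%E).
      apply: leeD.
        apply: (le_trans (Hterm _ _ (Gshort u))).
        by rewrite -muleA lee_wpmul2r.
      rewrite lee_wpmul2l ?lee_fin//.
      apply: (le_trans (Hterm _ _ (Glong u))).
      rewrite -muleA -[leRHS]mul1e lee_wpmul2r//.
      by apply: probability_le1; apply: mG (Glong u).
    rewrite PEE -!EFinM -EFinD lee_fin exprD le_eqVlt; apply/orP; left.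
    by apply/eqP; ring.
  rewrite nneseriesZl; last first.
    by move=> k _; rewrite lee_fin mulr_ge0// exprn_ge0.
  rewrite PEE -!EFinM mulrAC [leRHS]EFinM lee_wpmul2l// lee_fin.
  by rewrite mulr_ge0 ?addr_ge0// mulr_ge0// exprn_ge0.
rewrite PEE -EFinM in HF HG *.
rewrite addSn exprS; apply: (@le_trans _ _
  (a * (pe * m ^+ s + (delta + eps) * phi * (pe * m ^+ s)))%:E).
  rewrite EFinM lee_wpmul2l ?lee_fin// EFinD leeD//.
have -> : a * (pe * m ^+ s + (delta + eps) * phi * (pe * m ^+ s)) =
  a * (1 + (delta + eps) * phi) * (pe * m ^+ s) by ring.
rewrite [leRHS](_ : _ = (m * (pe * m ^+ s))%:E); last by rewrite -EFinM mulrCA.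
by rewrite lee_fin ler_wpM2r// mulr_ge0// exprn_ge0.
Qed.

(** Each of the independent trees contributes at most a factor [m], whatever the
    number of generations. *)
Lemma integral_prod_progeny_exp n es ls :
  independent_events G es -> fresh_roots (unzip1 es) ls ->
  (\int[Pr]_(w in cylinder es) (\prod_(l <- ls) progeny_exp n l w)%:E <=
   Pr (cylinder es) * (m ^+ size ls)%:E)%E.
Proof.
elim: n es ls => [|n IHn] es ls ies fr.
  under eq_integral do rewrite big1//.
  rewrite integral_cst ?mul1e; last exact: measurable_cylinder ies.
  by rewrite -[leLHS]mule1 lee_wpmul2l// lee_fin exprn_ege1.
have := @integral_prod_progeny_exp_step n IHn ls es [::] ies.
rewrite cats0 addn0 => /(_ fr); apply: le_trans.
rewrite le_eqVlt; apply/orP; left; apply/eqP; apply: eq_integral => w _.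
by rewrite big_nil mulr1.
Qed.

(** Conditionally on their number, the initial particles start independent trees. *)
Lemma integral_forest n (N : W -> nat) :
  (forall k, G (Initial d) (N @^-1` [set k])) ->
  (\int[Pr]_w (\prod_(i < N w) progeny_exp n (i : nat, [::]) w)%:E <=
   \int[Pr]_w (m ^+ N w)%:E)%E.
Proof.
move=> GN; have mN k : measurable (N @^-1` [set k]) by exact: mG (GN k).
have TE : [set: W] = \bigcup_k (N @^-1` [set k]).
  by apply/seteqP; split=> // w _; exists (N w).
have tN : trivIset setT (fun k => N @^-1` [set k]).
  by apply/trivIsetP => i j _ _ /eqP ij; apply/seteqP; split=> // w [/= wi wj];
    apply: ij; rewrite -wi -wj.
have mm : measurable_fun setT (fun w => (m ^+ N w)%:E).
  apply/measurable_EFinP.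
  by apply: (measurable_random_index (N := N) (F := fun k _ => m ^+ k)).
have mp : measurable_fun setT
    (fun w => (\prod_(i < N w) progeny_exp n (i : nat, [::]) w)%:E).
  apply/measurable_EFinP; apply: (measurable_random_index (N := N)
    (F := fun k w => \prod_(i < k) progeny_exp n (i : nat, [::]) w)) => // k.
  rewrite (_ : (fun w => _) =
    fun w => \prod_(i <- index_enum 'I_k) progeny_exp n (i : nat, [::]) w)//.
  by apply: measurable_prod_seq => i; exact: measurable_progeny_exp.
rewrite TE !ge0_integral_bigcup//; last 4 first.
- by rewrite -TE.
- by move=> w _; rewrite lee_fin exprn_ge0.
- by rewrite -TE.
- by move=> w _; rewrite lee_fin prodr_ge0// => i _; exact: progeny_exp_ge0.
apply: lee_nneseries => [k _ _|k _].
  by apply: integral_ge0 => w _; rewrite lee_fin prodr_ge0// => i _;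
    exact: progeny_exp_ge0.
rewrite [leRHS](_ : _ = \int[Pr]_(w in N @^-1` [set k]) (cst (m ^+ k)%:E w))%E; last first.
  by apply: eq_integral => w; rewrite inE /= => ->.
rewrite integral_cst// muleC.
have ies : independent_events G [:: (Initial d, N @^-1` [set k])].
  by apply/independent_events_cons; split => //; split.
have fr : fresh_roots (unzip1 [:: (Initial d, N @^-1` [set k])])
    [seq (i, [::]) | i <- iota 0 k].
  split; first by rewrite map_inj_uniq ?iota_uniq// => i j [].
    by move=> _ _ /mapP[i _ ->] /mapP[j _ ->] /andP[/= /eqP ->].
  by move=> s l; rewrite inE => /eqP ->.
have := integral_prod_progeny_exp n ies fr.
rewrite /= setIT size_map size_iota; apply: le_trans.
rewrite le_eqVlt; apply/orP; left; apply/eqP; apply: eq_integral => w.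
rewrite inE /= => ->; rewrite big_map -[in RHS](subn0 k) -/(index_iota _ _).
by rewrite big_mkord.
Qed.

End progeny_moment.

(** * Pathwise domination of the number of particles *)

(** A consequence of the convexity of [x |-> expR (x * y)] on [[0, 1]], proved by
    averaging the two tangent inequalities [e1] and [e2] at [x]. *)
Lemma expR_chord (R : realType) (x y : R) : 0 <= x <= 1 ->
  expR (x * y) <= 1 + x * expR y.
Proof.
move=> /andP[x0 x1].
have e1 : expR (x * y) * (1 + (1 - x) * y) <= expR y.
  have -> : expR y = expR (x * y) * expR ((1 - x) * y).
    by rewrite -expRD; congr expR; ring.
  by rewrite ler_pM2l ?expR_gt0 ?expR_ge1Dx.
have e2 : expR (x * y) * (1 - x * y) <= 1.
  by rewrite -[leRHS]expR0 -(subrr (x * y)) expRD ler_pM2l ?expR_gt0 ?expR_ge1Dx.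
have e3 := ler_wpM2l x0 e1.
have e4 : (1 - x) * (expR (x * y) * (1 - x * y)) <= (1 - x) * 1.
  by rewrite ler_wpM2l// subr_ge0.
rewrite (_ : expR (x * y) = x * (expR (x * y) * (1 + (1 - x) * y)) +
  (1 - x) * (expR (x * y) * (1 - x * y))); last by ring.
by rewrite [leRHS]addrC lerD// (le_trans e4)// mulr1 gerBl.
Qed.

Lemma expR_sum_seq (R : realType) (I : Type) (s : seq I) (F : I -> R) :
  expR (\sum_(i <- s) F i) = \prod_(i <- s) expR (F i).
Proof.
by elim: s => [|i s IH]; rewrite ?big_nil ?expR0// !big_cons expRD IH.
Qed.

Section descendants.
Context {disp} {W : measurableType disp} {R : realType}.
Variables (short : label -> set W) (off : label -> W -> nat) (eps kappa : R) (w : W).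
Hypothesis eps01 : 0 <= eps <= 1.
Hypothesis kappa0 : 0 <= kappa.

Let eps0 : 0 <= eps. Proof. by have /andP[] := eps01. Qed.

(** The tree of [u] cut at generation [n], as a list, so that a finite set of living
    particles can be compared with it by counting. *)
Fixpoint descendants n u : seq label :=
  if n is n'.+1 then
    u :: flatten [seq descendants n' (child u k) | k <- iota 0 (off u w)]
  else [::].

Fixpoint long_ancestors (i : nat) (v : seq nat) : nat :=
  if v is _ :: v' then (long_ancestors i v' + (w \notin short (i, v')))%N else 0%N.

Fixpoint weighted_size n u : R :=
  if n is n'.+1 then
    1 + weight short eps u w *
      \sum_(k <- iota 0 (off u w)) weighted_size n' (child u k)
  else 0.

Lemma weighted_size_ge0 n u : 0 <= weighted_size n u.
Proof.
elim: n u => [|n IH] u //=; rewrite addr_ge0// mulr_ge0 ?weight_ge0//.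
by apply: sumr_ge0.
Qed.

(** The weight of a particle with at most [K] long-lived ancestors is at least
    [eps ^+ K]. *)
Lemma descendants_weighted n u K :
  (count (fun x => long_ancestors x.1 x.2 <= K)%N (descendants n u))%:R * eps ^+ K <=
  eps ^+ (long_ancestors u.1 u.2) * weighted_size n u.
Proof.
elim: n u => [|n IH] u /=; first by rewrite mul0r mulr0.
rewrite count_flatten sumnE !big_map natrD mulrDl mulrDr mulr1; apply: lerD.
  case: leqP => uK; last by rewrite mul0r exprn_ge0.
  by rewrite mulr1n mul1r; have /andP[_ e1] := eps01; apply: ler_wiXn2l.
rewrite natr_sum mulr_suml mulrA mulr_sumr; apply: ler_sum => k _.
apply: (le_trans (IH (child u k))); rewrite /= exprD -surjective_pairing.
rewrite ler_wpM2r ?weighted_size_ge0// ler_wpM2l ?exprn_ge0//.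
by rewrite /weight; case: (w \in short u).
Qed.

(** [expR_chord] at each branching, with the weight as abscissa. *)
Lemma expR_weighted_size n u :
  expR (kappa * weighted_size n u) <= progeny_exp short off eps (expR kappa) n u w.
Proof.
elim: n u => [|n IH] u /=; first by rewrite mulr0 expR0.
rewrite mulrDr mulr1 expRD ler_pM2l ?expR_gt0// mulrCA.
apply: (le_trans (expR_chord _ _)).
  by rewrite /weight; case: ifP => _ //; rewrite ler01 lexx.
rewrite lerD2l ler_wpM2l ?weight_ge0// mulr_sumr expR_sum_seq.
rewrite -[X in iota 0 X](subn0 (off u w)) -/(index_iota _ _) big_mkord.
by apply: ler_prod => k _; rewrite expR_ge0 IH.
Qed.

Lemma descendants_child n u x k : x \in descendants n u -> (k < off x w)%N ->
  child x k \in descendants n.+1 u.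
Proof.
elim: n u => [|n IH] u //; rewrite [in X in X -> _]/= in_cons => /orP[/eqP -> kO|].
  rewrite [descendants _ _]/= in_cons; apply/orP; right; apply/flatten_mapP.
  exists k; first by rewrite mem_iota.
  by rewrite mem_head.
move=> /flatten_mapP[j jO xj] kO; rewrite [descendants _ _]/= in_cons; apply/orP; right.
by apply/flatten_mapP; exists j => //; exact: IH.
Qed.

Lemma expR_count_forest (N n K : nat) (F : seq label) : uniq F ->
  (forall x, x \in F -> (x.1 < N)%N /\ x \in descendants n (x.1, [::])) ->
  (forall x, x \in F -> (long_ancestors x.1 x.2 <= K)%N) ->
  expR (kappa * eps ^+ K * (size F)%:R) <=
  \prod_(i < N) progeny_exp short off eps (expR kappa) n (i : nat, [::]) w.
Proof.
move=> uF FD FK.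
pose forest := flatten [seq descendants n (i, [::]) | i <- iota 0 N].
have sF : (size F <= count (fun x => long_ancestors x.1 x.2 <= K)%N forest)%N.
  rewrite -size_filter; apply: uniq_leq_size => // x xF.
  rewrite mem_filter FK//=; have [xN xd] := FD _ xF.
  by apply/flatten_mapP; exists x.1 => //; rewrite mem_iota.
apply: (@le_trans _ _ (expR (kappa * \sum_(i <- iota 0 N) weighted_size n (i, [::])))).
  rewrite ler_expR -mulrA ler_wpM2l// mulrC.
  apply: (@le_trans _ _
    ((count (fun x => long_ancestors x.1 x.2 <= K)%N forest)%:R * eps ^+ K)).
    by rewrite ler_wpM2r ?exprn_ge0// ler_nat.
  rewrite count_flatten sumnE !big_map natr_sum mulr_suml; apply: ler_sum => i _.
  by apply: (le_trans (descendants_weighted _ _ _)); rewrite /= mul1r.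
rewrite mulr_sumr expR_sum_seq.
rewrite -[X in iota 0 X](subn0 N) -/(index_iota _ _) big_mkord.
by apply: ler_prod => i _; rewrite expR_ge0 expR_weighted_size.
Qed.

End descendants.

Section particle_system.
Context {disp} {W : measurableType disp} {R : realType} {d : nat}.
Variables (D : particle_data R d W) (O : label -> W -> nat) (s eps kappa : R).
Variable K : nat.
Hypothesis s0 : 0 < s.
Hypothesis eps01 : 0 <= eps <= 1.
Hypothesis kappa0 : 0 <= kappa.
Hypothesis sK : 1 < s * K.+1%:R.

Definition short_lived (u : label) : set W :=
  [set w | (lifetime D u w <= s%:E)%E].

Variable w : W.
Hypothesis Lpos : forall u, (0 < lifetime D u w)%E.
Hypothesis offO : forall u, offspring D u w = O u w \/ lifetime D u w = +oo%E.

Lemma birth_ge0 i v : (0 <= birth D w i v)%E.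
Proof. by elim: v => [|k v IH] //=; rewrite adde_ge0// ltW. Qed.

(** Each long-lived ancestor delays the birth by more than [s], and the lifetimes of
    the others are nonnegative. *)
Lemma birth_ge_long i v :
  (((long_ancestors short_lived w i v)%:R * s)%:E <= birth D w i v)%E.
Proof.
elim: v => [|k v IH] /=; first by rewrite mul0r.
rewrite natrD mulrDl EFinD leeD//.
case: (boolP (w \in _)) => [_|/negP]; first by rewrite mul0r ltW.
by rewrite inE /= /short_lived /= mul1r => /negP; rewrite -ltNge => /ltW.
Qed.

Lemma long_ancestors_le i v : (birth D w i v <= 1)%E ->
  (long_ancestors short_lived w i v <= K)%N.
Proof.
move=> b1; rewrite leqNgt; apply/negP => Kl.
have := le_trans (birth_ge_long i v) b1; rewrite lee_fin leNgt => /negP; apply.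
by apply: (lt_le_trans sK); rewrite mulrC ler_pM2r// ler_nat.
Qed.

Lemma descendants_mono n n' u x : (n <= n')%N ->
  x \in descendants O w n u -> x \in descendants O w n' u.
Proof.
elim: n n' u => [|n IH] [|n'] u //= nn'; rewrite !in_cons => /orP[->//|].
move=> /flatten_mapP[k kO xk]; apply/orP; right; apply/flatten_mapP.
by exists k => //; exact: IH xk.
Qed.

(** A particle whose offspring number differs from [O] never dies, so its children
    are not born before time 1. *)
Lemma in_tree_descendants i v : in_tree D w i v -> (birth D w i v <= 1)%E ->
  (i, v) \in descendants O w (size v).+1 (i, [::]) /\ (i < init_number D w)%N.
Proof.
elim: v => [|k v IH] /=; first by move=> ->; rewrite mem_head.
move=> /andP[vt kO] b1.
have bv1 : (birth D w i v <= 1)%E.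
  by apply: le_trans b1; rewrite leeDl// ltW.
have [vd iN] := IH vt bv1; split=> //.
have kO' : (k < O (i, v) w)%N.
  have [<-//|Loo] := offO (i, v).
  by move: b1; rewrite Loo addey ?leye_eq// gt_eqF// (lt_le_trans _ (birth_ge0 i v)).
exact: (descendants_child vd kO').
Qed.

(** The right-hand side does not depend on [t], so the bound passes to the supremum
    over time; it also shows that the living particles are finitely many as soon as
    the right-hand side is finite. *)
Lemma expeR_count_alive (t : R) : t <= 1 ->
  (expeR ((kappa * eps ^+ K)%:E *
     empirical_measure D w t [set: borel (torus R d)]) <=
   ereal_sup (range (fun n => (\prod_(i < init_number D w)
     progeny_exp short_lived O eps (expR kappa) n (i : nat, [::]) w)%:E)))%E.
Proof.
move=> t1; set V := ereal_sup _.
have V1 : (1 <= V)%E.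
  apply: (@le_trans _ _ (\prod_(i < init_number D w)
     progeny_exp short_lived O eps (expR kappa) 0 (i : nat, [::]) w)%:E).
    by rewrite /= big1.
  by apply: ereal_sup_ubound; exists 0%N.
pose c := kappa * eps ^+ K.
have c0 : 0 <= c by rewrite mulr_ge0// exprn_ge0//; have /andP[] := eps01.
have HF (F : seq label) : uniq F -> {in F, forall x, alive D w t x} ->
    ((expR (c * (size F)%:R))%:E <= V)%E.
  move=> uF FA.
  pose n := (\max_(x <- F) (size x.2).+1)%N.
  have FB x : x \in F -> in_tree D w x.1 x.2 /\ (birth D w x.1 x.2 <= 1)%E.
    move=> /FA[xt /andP[bt _]]; split=> //.
    by apply: (le_trans bt); rewrite lee_fin.
  apply: (@le_trans _ _ (\prod_(i < init_number D w)
     progeny_exp short_lived O eps (expR kappa) n (i : nat, [::]) w)%:E).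
    rewrite lee_fin /c; apply: expR_count_forest => // x xF.
      have [xt xb] := FB x xF; have [xd xN] := in_tree_descendants xt xb.
      split=> //; apply: (descendants_mono (n := (size x.2).+1)).
        exact: (@leq_bigmax_seq _ F predT (fun x : label => (size x.2).+1) x).
      by rewrite [x in x \in _]surjective_pairing.
    by have [_ xb] := FB x xF; exact: long_ancestors_le.
  by apply: ereal_sup_ubound; exists n.
move: V V1 HF => [v| |] // v1 HF; last by rewrite leey.
rewrite lee_fin in v1; have v0 : 0 < v by exact: lt_le_trans v1.
have {}HF F : uniq F -> {in F, forall x, alive D w t x} -> c * (size F)%:R <= ln v.
  move=> uF FA; rewrite -ler_expR lnK ?posrE// -lee_fin; exact: HF.
rewrite (_ : v%:E = expeR (ln v)%:E); last by rewrite /= lnK// posrE.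
rewrite lee_expeR.
have [cE|cn0] := eqVneq c 0; first by rewrite -/c cE mul0e lee_fin ln_ge0.
have {}c0 : 0 < c by rewrite lt_neqAle eq_sym cn0.
rewrite -/c muleC -lee_pdivlMr// -EFinM.
apply: ge_ereal_sup => _ [A [finA AS] <-].
rewrite (fsbig_finite _ _ finA) /=.
rewrite (eq_bigr (fun=> 1%E)); last by move=> x _; rewrite diracT.
rewrite big_const_seq count_predT.
have -> n : iter n (+%R 1%E) 0 = n%:R%:E :> \bar R.
  by elim: n => [//|n IH]; rewrite iterS IH -[n.+1]add1n natrD.
rewrite lee_fin ler_pdivlMr// mulrC.
apply: HF; first exact: finmap.fset_uniq.
by move=> x; rewrite in_fset_set// inE => /AS.
Qed.

End particle_system.

(** * The exponential moment of the supremum of the mass *)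

Section sources.
Context {disp} {W : measurableType disp} {R : realType}.

Lemma sigma_of_measurable (I : Type) disp' (T : measurableType disp')
    (X : I -> W -> T) : (forall i, measurable_fun setT (X i)) ->
  sigma_of X `<=` measurable.
Proof.
move=> mX; apply: smallest_sub; first exact: sigma_algebra_measurable.
by move=> _ [i _ [B mB <-]]; exact: mX.
Qed.

Lemma sigma_of_preimage (I : Type) disp' (T : measurableType disp')
    (X : I -> W -> T) i B : measurable B -> sigma_of X (X i @^-1` B).
Proof.
by move=> mB; apply: sub_sigma_algebra; exists i => //; exists B; rewrite ?setTI.
Qed.

Lemma source_algebra_measurable (d : nat) (Pr : probability W R) nu q
    (D : particle_data R d W) : branching_system Pr nu q D ->
  forall s A, source_algebra D s A -> measurable A.
Proof.
move=> [[mN mpos] mL mO mB _] [|u|u|u j] A /=.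
- apply: smallest_sub; first exact: sigma_algebra_measurable.
  by move=> B [|]; apply: sigma_of_measurable.
- by apply: sigma_of_measurable => _; have [] := mL u.
- by apply: sigma_of_measurable => _; have [] := mO u.
- by apply: sigma_of_measurable => -[t t0] /=; have [+ _ _ _ _] := mB u j; exact.
Qed.

(** Labels are countably many. *)
Lemma ae_label (Pr : probability W R) (P : label -> W -> Prop) :
  (forall u, {ae Pr, forall w, P u w}) -> {ae Pr, forall w u, P u w}.
Proof.
move=> H.
have : {ae Pr, forall w (n : nat),
    if (unpickle n : option label) is Some u then P u w else True}.
  apply: ae_foralln => n; case: (unpickle n) => [u|]; first exact: H.
  exact: aeW.
by apply: filterS => w Hw u; have := Hw (pickle u); rewrite pickleK.
Qed.

Lemma ae_of_prob1 (Pr : probability W R) (A : set W) : measurable A -> Pr A = 1%E ->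
  {ae Pr, forall w, A w}.
Proof.
move=> mA PA; exists (~` A); split; [exact: measurableC| |by []].
by rewrite probability_setC// PA subee.
Qed.

End sources.

Section system_facts.
Context {disp} {W : measurableType disp} {R : realType} {d : nat}.
Variables (Pr : probability W R) (nu : R) (q : nat -> R) (D : particle_data R d W).
Hypothesis sys : branching_system Pr nu q D.

Let mG := source_algebra_measurable sys.
Let lam := branching_rate q.

Lemma lifetime_gt0_ae : {ae Pr, forall w (u : label), (0 < lifetime D u w)%E}.
Proof.
have [_ mL _ _ _] := sys.
apply: (ae_label (P := fun u w => 0 < lifetime D u w)%E) => u.
have [mLu PL] := mL u; apply: ae_of_prob1; last first.
  by rewrite (PL 0)// mulr0 oppr0 expR0.
by rewrite -[X in measurable X]setTI; exact: emeasurable_fun_o_infty.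
Qed.

Lemma lifetime_infty_ae : lam = 0 ->
  {ae Pr, forall w (u : label), lifetime D u w = +oo%E}.
Proof.
move=> lam0; have [_ mL _ _ _] := sys.
apply: (ae_label (P := fun u w => lifetime D u w = +oo%E)) => u.
have [mLu PL] := mL u.
have : {ae Pr, forall w (n : nat), (n%:R%:E < lifetime D u w)%E}.
  apply: ae_foralln => n; apply: ae_of_prob1.
    by rewrite -[X in measurable X]setTI; exact: emeasurable_fun_o_infty.
  by rewrite PL// -/lam lam0 mul0r oppr0 expR0.
apply: filterS => w Hw; apply/eqyP => r r0.
apply: le_trans (ltW (Hw (Num.truncn r).+1)); rewrite lee_fin ltW//.
exact: truncnS_gt.
Qed.

Lemma lifetime_le_prob s u : 0 <= lam -> 0 <= s ->
  (Pr (short_lived D s u) <= (lam * s)%:E)%E.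
Proof.
move=> lam0 s0; have [_ mL _ _ _] := sys; have [mLu PL] := mL u.
have mA : measurable [set w | (s%:E < lifetime D u w)%E].
  by rewrite -[X in measurable X]setTI; exact: emeasurable_fun_o_infty.
rewrite (_ : short_lived D s u = ~` [set w | (s%:E < lifetime D u w)%E]); last first.
  by apply/seteqP; split=> w /=; rewrite /short_lived /= leNgt => /negP.
rewrite probability_setC// PL// -EFinB lee_fin lerBlDr -lerBlDl.
by apply: le_trans (expR_ge1Dx _).
Qed.

Lemma short_lived_source s u : source_algebra D (Clock d u) (short_lived D s u).
Proof.
rewrite (_ : short_lived D s u = lifetime D u @^-1` [set x | (x <= s%:E)%E])//.
apply: (sigma_of_preimage (X := fun _ : unit => lifetime D u) tt).
by rewrite -[X in measurable X]setTI; apply: emeasurable_fun_infty_c.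
Qed.

Lemma long_lived_source s u : source_algebra D (Clock d u) (~` short_lived D s u).
Proof.
rewrite (_ : ~` _ = lifetime D u @^-1` (~` [set x | (x <= s%:E)%E]))//.
apply: (sigma_of_preimage (X := fun _ : unit => lifetime D u) tt).
apply: measurableC.
by rewrite -[X in measurable X]setTI; apply: emeasurable_fun_infty_c.
Qed.

(** With zero branching rate no particle dies, and the offspring numbers, whose law
    is then arbitrary, are replaced by 0. *)
Definition effective_offspring (u : label) (w : W) : nat :=
  if lam == 0 then 0%N else offspring D u w.

Definition offspring_law (k : nat) : R :=
  if lam == 0 then (k == 0%N)%:R else q k / lam.

Lemma effective_offspring_source u k :
  source_algebra D (Offspring d u) (effective_offspring u @^-1` [set k]).
Proof.
have mk : measurable [set k] by [].
rewrite /effective_offspring; case: eqP => _; last first.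
  exact: (sigma_of_preimage (X := fun _ : unit => offspring D u) tt mk).
rewrite (_ : _ @^-1` _ = offspring D u @^-1` (if k == 0%N then setT else set0)).
  apply: (sigma_of_preimage (X := fun _ : unit => offspring D u) tt).
  by case: ifP.
by apply/seteqP; case: k {mk} => [|k]; split.
Qed.

Lemma effective_offspring_prob u k : 0 <= lam ->
  Pr (effective_offspring u @^-1` [set k]) = (offspring_law k)%:E.
Proof.
move=> lam0; rewrite /effective_offspring /offspring_law; case: eqP => [_|/eqP lamN].
  case: k => [|k] /=.
    rewrite (_ : _ @^-1` _ = setT) ?probability_setT//.
    by apply/seteqP; split.
  rewrite (_ : _ @^-1` _ = set0) ?measure0//.
  by apply/seteqP; split.
have [_ _ mO _ _] := sys; have [_ +] := mO u; apply.
by rewrite lt_neqAle eq_sym lamN.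
Qed.

Lemma init_number_source k :
  source_algebra D (Initial d) (init_number D @^-1` [set k]).
Proof.
apply: sub_sigma_algebra; left.
exact: (sigma_of_preimage (X := fun _ : unit => init_number D) tt).
Qed.

End system_facts.
Lemma branching_rate_ge0 (R : realType) (q : nat -> R) :
  branching_mechanism q -> 0 <= branching_rate q.
Proof.
move=> [q0 _ cq _]; apply: limr_ge => //; apply: nearW => n.
by rewrite /series /=; apply: sumr_ge0.
Qed.

Lemma offspring_law_ge0 (R : realType) (q : nat -> R) k :
  branching_mechanism q -> 0 <= offspring_law q k.
Proof.
move=> hq; rewrite /offspring_law; case: ifP => _ //.
by have [q0 _ _ _] := hq; rewrite divr_ge0// branching_rate_ge0.
Qed.

(** The series in the hypothesis skips the index 1, where [q] vanishes. *)
Lemma offspring_moment (R : realType) (q : nat -> R) (thetaq theta : R) :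
  branching_mechanism q ->
  (\sum_(0 <= k <oo | k != 1%N) (q k * expR (k%:R * thetaq))%:E < +oo)%E ->
  theta <= thetaq ->
  (\sum_(0 <= k <oo) (offspring_law q k * expR theta ^+ k)%:E < +oo)%E.
Proof.
move=> hq hth thle; have [q0 q1 _ _] := hq; have lam0 := branching_rate_ge0 hq.
have p0 k := offspring_law_ge0 k hq.
have [lamE|lamN] := eqVneq (branching_rate q) 0.
  rewrite (nneseries_split 0 1); last first.
    by move=> k _; rewrite lee_fin mulr_ge0// exprn_ge0// expR_ge0.
  rewrite eseries0 => [|[|k] //]; last first.
    by move=> _ _; rewrite /offspring_law lamE eqxx mul0r.
  by rewrite adde0 big_mkord big_ord1 ltry.
have lamp : 0 < branching_rate q by rewrite lt_neqAle eq_sym lamN.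
apply: (@le_lt_trans _ _ ((branching_rate q)^-1%:E *
    \sum_(0 <= k <oo | k != 1%N) (q k * expR (k%:R * thetaq))%:E)%E); last first.
  by rewrite lte_mul_pinfty// lee_fin invr_ge0.
rewrite [X in (_ <= _ * X)%E]eseries_mkcond -nneseriesZl; last first.
  by move=> k _; case: ifP => // _; rewrite lee_fin mulr_ge0// expR_ge0.
apply: lee_nneseries => k _.
  by rewrite lee_fin mulr_ge0// exprn_ge0// expR_ge0.
rewrite /offspring_law (negPf lamN) -expRM_natl.
have [->|k1] := eqVneq k 1%N; first by rewrite q1 mul0r mul0r mule0.
rewrite /= -EFinM lee_fin mulrC [leRHS]mulrA [_^-1 * _]mulrC [leRHS]mulrC.
rewrite ler_wpM2r ?divr_ge0// ler_expR ler_wpM2l//.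
Qed.
Section equal_laws.
Context {d1 d2 d3} {T1 : measurableType d1} {T2 : measurableType d2}
  {Y : measurableType d3} {R : realType}.
Variables (P1 : probability T1 R) (P2 : probability T2 R) (f1 : T1 -> Y) (f2 : T2 -> Y).
Hypotheses (mf1 : measurable_fun setT f1) (mf2 : measurable_fun setT f2).

Let mfun1 : {mfun T1 >-> Y} := HB.pack f1 (isMeasurableFun.Build _ _ _ _ _ mf1).
Let mfun2 : {mfun T2 >-> Y} := HB.pack f2 (isMeasurableFun.Build _ _ _ _ _ mf2).

Lemma integral_equal_laws (h : Y -> \bar R) :
  (forall B, measurable B -> P1 (f1 @^-1` B) = P2 (f2 @^-1` B)) ->
  measurable_fun setT h -> (forall y, 0 <= h y)%E ->
  (\int[P1]_x h (f1 x) = \int[P2]_x h (f2 x))%E.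
Proof.
move=> law mh h0.
have E1 := ge0_integral_pushforward mf1 P1 measurableT mh (fun y _ => h0 y).
have E2 := ge0_integral_pushforward mf2 P2 measurableT mh (fun y _ => h0 y).
transitivity (\int[pushforward P1 mfun1]_y h y)%E; first by rewrite [RHS]E1.
transitivity (\int[pushforward P2 mfun2]_y h y)%E; last by rewrite [LHS]E2.
by apply: eq_measure_integral => B mB _; exact: law.
Qed.
End equal_laws.


Section moment.
Context {R : realType} {d : nat}.

(** The initial particles have positive lifetimes, hence they are alive at time 0. *)
Lemma init_number_le_mass {disp} {W : measurableType disp}
    (D : particle_data R d W) (w : W) : (forall u, 0 < lifetime D u w)%E ->
  (((init_number D w)%:R)%:E <=
    empirical_measure D w 0 [set: borel (torus R d)])%E.
Proof.
move=> Lpos; pose A : set label := [set (i, [::]) | i in `I_(init_number D w)].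
have -> : ((init_number D w)%:R%:E = \sum_(x \in A) (1%E : \bar R))%E.
  rewrite /A fsbig_image//=; last by move=> i j _ _ [].
  rewrite -(fsbig_ord _ _ (fun=> 1%E)) big_const_ord.
  elim: (init_number D w) => [//|n IH].
  by rewrite iterS -IH -[n.+1]add1n natrD.
apply: ereal_sup_ubound; exists A.
  split; first exact: finite_image.
  move=> _ [i iN <-]; split => //=; rewrite lexx add0e /=; exact: Lpos.
by apply: eq_fsbigr => x _; rewrite diracT.
Qed.

(** The laws are compared after composition with the total mass, which is a Borel
    function of the measure. *)
Lemma integral_law_mass {disp} {W : measurableType disp} (Pr : probability W R)
    (R0 : probability (borel (fmeas R d)) R) (Y : W -> fmeas R d) (h : \bar R -> \bar R) :
  measurable_fun setT (fun w => Y w [set: borel (torus R d)]) ->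
  (forall A : set (borel (fmeas R d)), measurable A -> Pr [set w | A (Y w)] = R0 A) ->
  measurable_fun setT h -> (forall x, 0 <= h x)%E ->
  (\int[Pr]_w h (Y w [set: borel (torus R d)]) =
   \int[R0]_m h ((m : fmeas R d) [set: borel (torus R d)]))%E.
Proof.
move=> mY lawY mh h0.
apply: (integral_equal_laws mY (@measurable_mass R d)) => // B mB.
have := lawY ((fun m : fmeas R d => m [set: borel (torus R d)]) @^-1` B).
by apply; rewrite -[X in measurable X]setTI; exact: measurable_mass.
Qed.

(** The constants are chosen before the particle system is: they involve the law of
    the number of particles only, not their motion. *)
Lemma exponential_moment (q : nat -> R) (R0 : probability (borel (fmeas R d)) R) :
  branching_mechanism q ->
  (exists2 thetaq : R, 0 < thetaq &
      (\sum_(0 <= k <oo | k != 1%N) (q k * expR (k%:R * thetaq))%:E < +oo)%E) ->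
  (exists2 theta0 : R, 0 < theta0 &
      (\int[R0]_(m in [set: borel (fmeas R d)])
         expeR (theta0%:E * (m : fmeas R d) [set: borel (torus R d)]) < +oo)%E) ->
  exists2 kappa : R, 0 < kappa & exists2 K : R, 1 <= K &
    forall nu (Q : probability (borel (Omega R d)) R), is_BBM nu q R0 Q ->
    (\int[Q]_(w in [set: borel (Omega R d)])
             expeR (kappa%:E * sup_mass (w : Omega R d)) <= K%:E)%E.
Proof.
move=> hq [thetaq thetaq0 hthetaq] [theta0 theta00 htheta0].
have lam0 := branching_rate_ge0 hq; set lam := branching_rate q in lam0.
(* [expR theta] is the bound [m] for one tree: the generating function of the
   offspring law is finite there, and its powers are integrable under [R0]. *)
pose theta := Num.min thetaq theta0.
have th0 : 0 < theta by rewrite lt_min thetaq0.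
have thq : theta <= thetaq by rewrite ge_min lexx.
have thi : theta <= theta0 by rewrite ge_min lexx orbT.
have phioo := offspring_moment hq hthetaq thq.
set S := (\sum_(0 <= k <oo) _)%E in phioo.
have S0 : (0 <= S)%E.
  apply: nneseries_ge0 => k _ _.
  by rewrite lee_fin mulr_ge0 ?offspring_law_ge0// exprn_ge0// expR_ge0.
pose phi := fine S.
have phi0 : 0 <= phi by exact: fine_ge0.
have phiE : (S <= phi%:E)%E by rewrite fineK// ge0_fin_numE.
pose kappa1 := theta / 2.
have k10 : 0 < kappa1 by rewrite divr_gt0.
(* With [a = expR (theta / 2)], a mean weight of at most [eta] makes [expR theta] a
   supersolution; both [eps] and the probability of being short-lived are taken
   below [eta / 2]. Adding 1 to [phi] and to [lam] avoids divisions by 0. *)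
pose eta := (expR kappa1 - 1) / (phi + 1).
have phi1 : 0 < phi + 1 by rewrite ltr_wpDl.
have eta0 : 0 < eta by rewrite divr_gt0// subr_gt0 expR_gt1.
pose eps := Num.min 1 (eta / 2).
have eps0 : 0 < eps by rewrite lt_min ltr01 divr_gt0.
have eps01 : 0 <= eps <= 1 by rewrite ltW//= ge_min lexx.
pose delta := eta / 2.
have delta0 : 0 < delta by rewrite divr_gt0.
pose s := delta / (lam + 1).
have lam1 : 0 < lam + 1 by rewrite ltr_wpDl.
have s0 : 0 < s by rewrite divr_gt0.
have lams : lam * s <= delta.
  by rewrite mulrA ler_pdivrMr// [leLHS]mulrC ler_pM2l// lerDl.
pose K := Num.truncn s^-1.
have sK : 1 < s * K.+1%:R by rewrite -ltr_pdivrMl// mulr1 truncnS_gt.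
have fixpoint : expR kappa1 * (1 + (delta + eps) * phi) <= expR theta.
  have -> : expR theta = expR kappa1 * expR kappa1.
    by rewrite -expRD -splitr.
  rewrite ler_pM2l ?expR_gt0// -lerBrDl.
  have de : delta + eps <= eta by rewrite [leRHS]splitr lerD2l ge_min lexx orbT.
  apply: (@le_trans _ _ (eta * phi)); first by rewrite ler_wpM2r.
  rewrite /eta mulrAC ler_pdivrMr// ler_wpM2l ?lerDl// subr_ge0.
  by rewrite ltW// expR_gt1.
exists (kappa1 * eps ^+ K); first by rewrite mulr_gt0// exprn_gt0.
set I0 := (\int[R0]_(m in _) _)%E in htheta0.
have I00 : (0 <= I0)%E by apply: integral_ge0 => m _; exact: expeR_ge0.
exists (Num.max 1 (fine I0)); first by rewrite le_max lexx.
move=> nu Q [disp [W [Pr [D [X [sys mX XE X0 XQ]]]]]].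
pose O := effective_offspring q D.
pose Z n (w : W) := \prod_(i < init_number D w)
  progeny_exp (short_lived D s) O eps (expR kappa1) n (i : nat, [::]) w.
have mG := source_algebra_measurable sys.
have indG : independent Pr (source_algebra D) by have [_ _ _ _] := sys.
have [[mN _] mL _ _ _] := sys.
have e1 : 1 <= expR kappa1 by rewrite ltW// expR_gt1.
have eps0' : 0 <= eps by rewrite ltW.
have mN' k : measurable (init_number D @^-1` [set k]).
  exact: (mG _ _ (@init_number_source _ _ _ _ D k)).
have mZ n : measurable_fun setT (fun w => (Z n w)%:E).
  apply/measurable_EFinP; apply: (measurable_random_index (N := init_number D)
    (F := fun k w => \prod_(i < k)
      progeny_exp (short_lived D s) O eps (expR kappa1) n (i : nat, [::]) w)) => // k.
  rewrite (_ : (fun w => _) = fun w => \prod_(i <- index_enum 'I_k)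
    progeny_exp (short_lived D s) O eps (expR kappa1) n (i : nat, [::]) w)//.
  apply: measurable_prod_seq => i.
  apply: (measurable_progeny_exp mG) => //.
    by move=> u; exact: short_lived_source.
  by move=> u k'; exact: effective_offspring_source.
have Z0 n w : (0 <= (Z n w)%:E)%E.
  by rewrite lee_fin prodr_ge0// => i _; exact: progeny_exp_ge0.
have ndZ w : {homo (fun n => (Z n w)%:E) : n m / (n <= m)%N >-> (n <= m)%E}.
  apply/nondecreasing_seqP => n; rewrite lee_fin; apply: ler_prod => i _.
  by rewrite progeny_exp_ge0//= progeny_exp_le.
pose V w := ereal_sup (range (fun n => (Z n w)%:E)).
have cV w : (Z n w)%:E @[n --> \oo] --> V w by exact: ereal_nondecreasing_cvgn.
have mV : measurable_fun setT V.
  by apply: (emeasurable_fun_cvg (fun n w => (Z n w)%:E)).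
have Lpos := lifetime_gt0_ae sys.
have Loo : {ae Pr, forall w u, offspring D u w = O u w \/ lifetime D u w = +oo%E}.
  have [l0|lN0] := eqVneq lam 0.
    by apply: filterS (lifetime_infty_ae sys l0) => w Hw u; right.
  by apply: aeW => w u; left; rewrite /O /effective_offspring (negPf lN0).
(* The supremum over generations of the functional of the cut trees dominates the
   supremum over time of the mass. *)
have supV : {ae Pr, forall w, [set: W] w ->
    (expeR ((kappa1 * eps ^+ K)%:E * sup_mass (X w : Omega R d)) <= V w)%E}.
  apply: filterS2 (filterI Lpos XE) Loo => w [Lw Xw] Ow _.
  have V0 : (0 <= V w)%E.
    by apply: (le_trans (Z0 0%N w)); apply: ereal_sup_ubound; exists 0%N.
  have [y yV] := expeR_total V0; rewrite -yV lee_expeR.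
  have c0 : 0 < kappa1 * eps ^+ K by rewrite mulr_gt0// exprn_gt0.
  rewrite muleC -lee_pdivlMr//; apply: ge_ereal_sup => _ [t _ <-].
  rewrite lee_pdivlMr// muleC -lee_expeR yV Xw//.
  apply: expeR_count_alive => //; first exact: ltW.
  by have /andP[] := I01_val01 t.
have intV : (\int[Pr]_w V w <= (Num.max 1 (fine I0))%:E)%E.
  have cint := monotone_convergence_cvg mZ Z0 ndZ cV (mu := Pr).
  apply: (cvge_le _ cint); apply: nearW => n.
  apply: (@le_trans _ _ (\int[Pr]_w (expR theta ^+ init_number D w)%:E)%E).
    apply: (integral_forest indG mG
      (fun u => @short_lived_source _ _ _ _ D s u)
      (fun u => @long_lived_source _ _ _ _ D s u)
      (fun u k => @effective_offspring_source _ _ _ _ q D u k)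
      eps0' e1 _ (p := offspring_law q) _ (ltW delta0) _ _ phiE fixpoint n
      (fun k => @init_number_source _ _ _ _ D k)).
    - by rewrite ltW// expR_gt1.
    - by move=> k; exact: offspring_law_ge0.
    - move=> u; apply: (le_trans (lifetime_le_prob sys u lam0 (ltW s0))).
      by rewrite lee_fin.
    - by move=> u k; exact: (effective_offspring_prob sys).
  apply: (@le_trans _ _ I0); last first.
    by rewrite -(fineK (x := I0)) ?ge0_fin_numE// lee_fin le_max lexx orbT.
  have mX0 : measurable_fun setT
      (fun w => (X w : Omega R d) (I01_0 R) [set: borel (torus R d)]).
    exact: measurableT_comp (@measurable_mass_at R d (I01_0 R) _ measurableT) mX.
  have mh : measurable_fun setT (fun x : \bar R => expeR (theta0%:E * x)).
    apply: measurableT_comp; first exact: measurable_expeR.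
    by apply: emeasurable_funM => //; exact: measurable_cst.
  rewrite /I0 -(integral_law_mass (Y := fun w => (X w : Omega R d) (I01_0 R)) mX0 X0 mh)//;
    last by move=> x; exact: expeR_ge0.
  apply: ae_ge0_le_integral => //.
  - apply/measurable_EFinP; by apply: (measurable_random_index (N := init_number D)
      (F := fun k _ => expR theta ^+ k)).
  - by move=> w _; exact: expeR_ge0.
  - exact: measurableT_comp mh mX0.
  apply: filterS2 Lpos XE => w Lw Xw _; rewrite Xw//.
  have Nle := init_number_le_mass Lw.
  rewrite -expRM_natl (_ : (expR _)%:E = expeR ((init_number D w)%:R * theta)%:E)//.
  rewrite lee_expeR.
  apply: (@le_trans _ _ (theta0%:E * (init_number D w)%:R%:E)%E).
    by rewrite -EFinM lee_fin mulrC ler_wpM2r.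
  by rewrite lee_wpmul2l// lee_fin ltW.
have msup : measurable_fun setT (fun x : borel (Omega R d) =>
    expeR ((kappa1 * eps ^+ K)%:E * sup_mass (x : Omega R d))).
  apply: measurableT_comp; first exact: measurable_expeR.
  by apply: emeasurable_funM; [exact: measurable_cst|exact: measurable_sup_mass].
rewrite -(integral_equal_laws (P1 := Pr) (P2 := Q) (f2 := idfun) mX
  (@measurable_id _ _ setT)
  (h := fun x => expeR ((kappa1 * eps ^+ K)%:E * sup_mass (x : Omega R d))))//; last first.
  by move=> x; exact: expeR_ge0.
apply: le_trans intV; apply: ae_ge0_le_integral => //.
- by move=> w _; exact: expeR_ge0.
- exact: measurableT_comp msup mX.
- by move=> w _; apply: (le_trans (Z0 0%N w)); apply: ereal_sup_ubound; exists 0%N.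
Qed.

End moment.

(** * Entropy bounds on the mass *)

(** The Gibbs inequality for [kappa * sup_mass]; the entropy is nonnegative, so that
    it can be multiplied by [Num.max 1 (ln K)]. *)
Lemma entropy_sup_mass (R : realType) (d : nat) (kappa K : R)
    (P Q : probability (borel (Omega R d)) R) : 0 < kappa -> 1 <= K ->
  (\int[Q]_(w in [set: borel (Omega R d)])
     expeR (kappa%:E * sup_mass (w : Omega R d)) <= K%:E)%E ->
  (entropy P Q < +oo)%E ->
  (\int[P]_(w in [set: borel (Omega R d)]) sup_mass (w : Omega R d) <=
   (Num.max 1 (ln K) / kappa)%:E * (1 + entropy P Q))%E.
Proof.
move=> k0 K1 HK Hfin.
have msup := @measurable_sup_mass R d.
have mk : measurable_fun [set: borel (Omega R d)]
    (fun w => kappa%:E * sup_mass (w : Omega R d))%E.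
  by apply: emeasurable_funM => //; exact: measurable_cst.
have ksup0 (w : borel (Omega R d)) : (0 <= kappa%:E * sup_mass (w : Omega R d))%E.
  by apply: mule_ge0; [rewrite lee_fin ltW|exact: sup_mass_ge0].
have := entropy_gibbs Hfin mk ksup0 K1 HK.
rewrite ge0_integralZl//; last 2 first.
- by move=> w _; exact: sup_mass_ge0.
- by rewrite lee_fin ltW.
have H0 := entropy_ge0 P Q.
move: (entropy P Q) H0 Hfin => [h| |] // h0 _; rewrite -EFinD muleC.
rewrite -lee_pdivlMr// => /le_trans; apply.
rewrite -EFinM -EFinD -EFinM lee_fin mulrAC ler_pM2r ?invr_gt0//.
rewrite lee_fin in h0; rewrite mulrDr mulr1 addrC lerD//.
  by rewrite le_max lexx orbT.
by rewrite ler_peMl// le_max lexx.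
Qed.

Theorem proposition2p56 (R : realType) (d : nat) (d_gt0 : (0 < d)%N)
    (q : nat -> R) (R0 : probability (borel (fmeas R d)) R)
    (hq : branching_mechanism q)
    (hR0 : {ae R0, forall m : fmeas R d, point_configuration m})
    (hthetaq : exists2 thetaq : R, 0 < thetaq &
      (\sum_(0 <= k <oo | k != 1%N) (q k * expR (k%:R * thetaq))%:E < +oo)%E)
    (htheta0 : exists2 theta0 : R, 0 < theta0 &
      (\int[R0]_(m in [set: borel (fmeas R d)])
         expeR (theta0%:E * (m : fmeas R d) [set: borel (torus R d)]) < +oo)%E) :
  exists2 C : R, 0 < C &
    forall (nu : R) (Q : probability (borel (Omega R d)) R),
    0 < nu -> is_BBM nu q R0 Q ->
    [/\ exists2 kappa : R, 0 < kappa &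
          (\int[Q]_(w in [set: borel (Omega R d)])
             expeR (kappa%:E * sup_mass (w : Omega R d)) < +oo)%E,
        forall P : probability (borel (Omega R d)) R, (entropy P Q < +oo)%E ->
          exists2 m : I01 R -> fmeas R d,
            (forall (t : I01 R) (A : set (borel (torus R d))), measurable A ->
               P.-integrable [set: borel (Omega R d)]
                 (fun w => (w : Omega R d) t A) /\
               m t A = mean_measure P t A) &
            cadlag m &
        forall P : probability (borel (Omega R d)) R, (entropy P Q < +oo)%E ->
          (ereal_sup (range (fun t : I01 R =>
             mean_measure P t [set: borel (torus R d)])) <=
           C%:E * (1 + entropy P Q))%E].
Proof.
have [kappa k0 [K K1 HK]] := exponential_moment hq hthetaq htheta0.
exists (Num.max 1 (ln K) / kappa); first by rewrite divr_gt0// lt_max ltr01.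
move=> nu Q nu0 /HK {}HK.
have mass_int (P : probability (borel (Omega R d)) R) t A : measurable A ->
    (\int[P]_w (w : Omega R d) t A <=
     \int[P]_(w in [set: borel (Omega R d)]) sup_mass (w : Omega R d))%E.
  move=> mA; apply: ge0_le_integral => //.
  - exact: measurable_mass_at.
  - exact: measurable_sup_mass.
  - move=> w _; apply: le_trans (mass_le_sup w t).
    by apply: le_measure; rewrite ?inE.
split.
- by exists kappa => //; apply: le_lt_trans HK _; rewrite ltry.
- move=> P Hfin; have supfin : (\int[P]_w sup_mass (w : Omega R d) < +oo)%E.
    apply: (le_lt_trans (entropy_sup_mass k0 K1 HK Hfin)).
    have H0 := entropy_ge0 P Q.
    by move: (entropy P Q) H0 Hfin => [h| |] // _ _; rewrite -EFinD -EFinM ltry.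
  exists (mean_path supfin); last exact: mean_path_cadlag.
  move=> t A mA; split=> //; apply/integrableP; split.
    exact: measurable_mass_at.
  under eq_integral do rewrite gee0_abs//.
  exact: le_lt_trans (mass_int P t A mA) supfin.
- move=> P Hfin; apply: ge_ereal_sup => _ [t _ <-].
  by apply: le_trans (mass_int P t _ measurableT) (entropy_sup_mass k0 K1 HK Hfin).
Qed.
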